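(* Consider the eleven directions in $\mathbb R^3$ $$e_1,\ e_2,\ e_3,\qquad \frac{(\sqrt3,0,\pm2)}{\sqrt7},\quad \frac{(0,\sqrt3,\pm2)}{\sqrt7},\quad \frac{(\sqrt3,\pm\sqrt3,\pm1)}{\sqrt7},$$ where the two signs in the last expression are independent. Replace every direction $v$ by its two antipodal representatives $\pm v\in S^2$. Give each of the four nodes $\pm e_1,\pm e_2$ weight $1/20$, each of the two nodes $\pm e_3$ weight $1/27$, and each of the remaining sixteen nodes weight $49/1080$. The resulting positive cubature formula on $S^2$ has degree seven. Hence $N_7=22$.
   Context: $e_1,e_2,e_3$ is the standard basis of $\mathbb R^3$. Let $\sigma$ be the normalized (probability) surface measure on $S^2\subset\mathbb R^3$. A positive cubature formula of degree $t$ consists of distinct nodes $x_1,\dots,x_N\in S^2$ and weights $w_i>0$ with $\int_{S^2} f\,d\sigma=\sum_i w_i f(x_i)$ for every real polynomial $f$ of total degree at most $t$. $N_t$ is the least possible number of nodes of a positive cubature formula of degree $t$. *)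

(* Defs.v *)
From HB Require Import structures.
From mathcomp Require Import all_boot all_order all_algebra.
(* mpoly must be imported before all_analysis: its notations cannot be added
   to the grammar afterwards. *)
From mathcomp Require Import mpoly.
From mathcomp Require Import all_classical all_reals all_analysis.
From mathcomp Require Import measurable_realfun ftc ring.

Set Implicit Arguments.
Unset Strict Implicit.
Unset Printing Implicit Defensive.

Import Order.TTheory GRing.Theory Num.Theory.
Import numFieldNormedType.Exports.

Local Open Scope classical_set_scope.
Local Open Scope ring_scope.

Section SurfaceMeasure.
Variable R : realType.

Definition vec3 (a b c : R) : 3.-tuple R := [tuple a; b; c].

Definition S2 : set (3.-tuple R) :=
  [set v | \sum_(i < 3) tnth v i ^+ 2 = 1].

(* p = (polar angle, azimuth), with area element sin p.1. *)
Definition spherical (p : R * R) : 3.-tuple R :=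
  vec3 (sin p.1 * cos p.2) (sin p.1 * sin p.2) (cos p.1).

Definition angles : set (R * R) := `[0, pi] `*` `[0, 2 * pi].

Definition surface_area (A : set (3.-tuple R)) : \bar R :=
  (\int[(@lebesgue_measure R) \x (@lebesgue_measure R)]_(p in
      angles `&` spherical @^-1` A) (sin p.1)%:E)%E.

Lemma measurable_spherical : measurable_fun [set: R * R] spherical.
Proof.
have msin1 : measurable_fun [set: R * R] (fun p : R * R => sin p.1).
  apply: measurableT_comp => //.
  by apply: continuous_measurable_fun; exact: continuous_sin.
have msin2 : measurable_fun [set: R * R] (fun p : R * R => sin p.2).
  apply: measurableT_comp => //.
  by apply: continuous_measurable_fun; exact: continuous_sin.
have mcos1 : measurable_fun [set: R * R] (fun p : R * R => cos p.1).
  apply: measurableT_comp => //.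
  by apply: continuous_measurable_fun; exact: continuous_cos.
have mcos2 : measurable_fun [set: R * R] (fun p : R * R => cos p.2).
  apply: measurableT_comp => //.
  by apply: continuous_measurable_fun; exact: continuous_cos.
apply/measurable_fun_tnthP; case; case=> [|[|[|//]]] i3.
- exact: measurable_funM.
- exact: measurable_funM.
- exact: mcos1.
Qed.

Lemma measurable_angles : measurable angles.
Proof. by apply: measurableX; exact: measurable_itv. Qed.

Lemma measurable_sin1 :
  measurable_fun [set: R * R] (fun p : R * R => (sin p.1)%:E).
Proof.
apply/measurable_EFinP; apply: measurableT_comp => //.
by apply: continuous_measurable_fun; exact: continuous_sin.
Qed.

Lemma angles_preimage A : measurable A ->
  measurable (angles `&` spherical @^-1` A).
Proof.
move=> mA; apply: measurableI; first exact: measurable_angles.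
by rewrite -[_ @^-1` _]setTI; exact: measurable_spherical.
Qed.

Lemma sin_angles_ge0 (p : R * R) : angles p -> (0 <= (sin p.1)%:E)%E.
Proof.
by move=> [/= p1 _]; rewrite lee_fin sin_ge0_pi//; rewrite in_itv in p1.
Qed.

Lemma surface_area0 : surface_area set0 = 0%E.
Proof. by rewrite /surface_area preimage_set0 setI0 integral_set0. Qed.

Lemma surface_area_ge0 A : (0 <= surface_area A)%E.
Proof. by apply: integral_ge0 => p [/sin_angles_ge0]. Qed.

Lemma surface_area_additive : semi_sigma_additive surface_area.
Proof.
move=> F mF tF mUF; rewrite /surface_area; apply: cvg_toP.
  apply: ereal_nondecreasing_is_cvgn => m n mn.
  apply: lee_sum_nneg_natr => // k _ _; exact: surface_area_ge0.
rewrite preimage_bigcup setI_bigcupr ge0_integral_bigcup//=.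
- by move=> k; exact: angles_preimage (mF k).
- by apply: measurable_funTS; exact: measurable_sin1.
- by move=> p [k _ [/sin_angles_ge0]].
- move=> i j _ _ [p [[_ Fip] [_ Fjp]]].
  by apply: (tF i j) => //; exists (spherical p).
Qed.

HB.instance Definition _ := isMeasure.Build _ _ _ surface_area
  surface_area0 surface_area_ge0 surface_area_additive.

Lemma surface_area_setT : surface_area [set: 3.-tuple R] = (4 * pi)%:E.
Proof.
rewrite /surface_area preimage_setT setIT integral_mkcond.
rewrite fubini_tonelli1 /=; last 2 first.
- apply/(measurable_restrictT _ measurable_angles).
  by apply: measurable_funTS; exact: measurable_sin1.
- by move=> p; rewrite erestrict_ge0// => q /sin_angles_ge0.
rewrite /fubini_F.
rewrite (_ : (fun x => _) =
    ((fun x : R => (2 * pi * sin x)%:E) \_ `[0, pi])); last first.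
  apply/funext => x; rewrite patchE; case: ifPn => [xI|xI].
    rewrite (_ : (fun y => _) = ((cst (sin x)%:E) \_ `[0, 2 * pi])); last first.
      apply/funext => y; rewrite !patchE /=; congr (if _ then _ else _).
      apply/idP/idP; rewrite !inE /angles /=; first by case.
      by split=> //; rewrite inE in xI.
    rewrite -integral_mkcond integral_cst//= lebesgue_measure_itv/= lte_fin.
    by rewrite mulr_gt0 ?pi_gt0// sube0 -EFinM mulrC.
  rewrite -[RHS](@integral0 _ _ _ (@lebesgue_measure R) setT).
  apply: eq_integral => y _; rewrite patchE; case: ifPn => //.
  by rewrite inE /angles /= => -[x1 _]; rewrite notin_setE in xI.
rewrite -integral_mkcond.
rewrite (@continuous_FTC2 _ _ (fun x => - (2 * pi) * cos x))//.
- by rewrite cospi cos0 -EFinB; congr (_%:E); ring.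
- exact: pi_gt0.
- apply: continuous_subspaceT => x.
  by apply: cvgM; [exact: cvg_cst|exact: continuous_sin].
- split.
  + by move=> x _; apply: derivableM => //; exact: derivable_cos.
  + apply: cvg_at_right_filter.
    by apply: cvgM; [exact: cvg_cst|exact: continuous_cos].
  + apply: cvg_at_left_filter.
    by apply: cvgM; [exact: cvg_cst|exact: continuous_cos].
- move=> x _; rewrite derive1E deriveM//.
  by rewrite derive_cst scaler0 addr0 derive_val /GRing.scale/= mulrNN.
Qed.

Lemma inv4pi_ge0 : 0 <= (4 * pi : R)^-1.
Proof. by rewrite invr_ge0 mulr_ge0 ?pi_ge0. Qed.

Definition sigma := mscale (NngNum inv4pi_ge0) surface_area.

HB.instance Definition _ := Measure.on sigma.

Lemma sigma_setT : sigma [set: 3.-tuple R] = 1%E.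
Proof.
rewrite /sigma /mscale/= surface_area_setT -EFinM mulVf//.
by rewrite gt_eqF// mulr_gt0 ?pi_gt0.
Qed.

HB.instance Definition _ :=
  @Measure_isProbability.Build _ _ R sigma sigma_setT.

Lemma spherical_S2 (p : R * R) : S2 (spherical p).
Proof.
rewrite /S2/= !big_ord_recl big_ord0 /=.
rewrite !(tnth_nth 0)/= addr0 !exprMn addrA -mulrDr cos2Dsin2 mulr1.
by rewrite addrC cos2Dsin2.
Qed.

Lemma sigma_S2 : sigma S2 = 1%E.
Proof.
rewrite -sigma_setT /sigma /mscale/= /surface_area preimage_setT.
congr (_ * integral _ _ _)%E; congr (_ `&` _).
by apply/seteqP; split=> // p _; exact: spherical_S2.
Qed.

End SurfaceMeasure.

Section Cubature.
Variable R : realType.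

Definition positive_cubature (t : nat) (I : finType) (x : I -> 3.-tuple R)
    (w : I -> R) : Prop :=
  [/\ injective x, forall i, S2 (x i), forall i, 0 < w i &
      forall f : {mpoly R[3]}, (msize f <= t.+1)%N ->
      (\int[@sigma R]_(v in @S2 R) (f.@[tnth v])%:E)%E =
      (\sum_i w i * f.@[tnth (x i)])%:E].

Definition has_cubature (t n : nat) : Prop :=
  exists (x : 'I_n -> 3.-tuple R) (w : 'I_n -> R), positive_cubature t x w.

(* The xget default 0 stands for "no formula of degree t exists": it is not a
   possible node count, since the empty sum does not integrate 1. *)
Definition min_nodes (t : nat) : nat :=
  xget 0%N [set n | has_cubature t n /\
                    forall m, has_cubature t m -> (n <= m)%N].

Definition directions : 11.-tuple (3.-tuple R) :=
  let s3 : R := Num.sqrt 3 in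
  let over7 (a b c : R) :=
    vec3 (a / Num.sqrt 7) (b / Num.sqrt 7) (c / Num.sqrt 7) in
  [tuple vec3 1 0 0; vec3 0 1 0; vec3 0 0 1;
         over7 s3 0 2; over7 s3 0 (- 2);
         over7 0 s3 2; over7 0 s3 (- 2);
         over7 s3 s3 1; over7 s3 s3 (- 1);
         over7 s3 (- s3) 1; over7 s3 (- s3) (- 1)].

Definition direction_weights : 11.-tuple R :=
  let a : R := 49 / 1080 in
  [tuple 1 / 20; 1 / 20; 1 / 27; a; a; a; a; a; a; a; a].

Definition node (i : 'I_11 * bool) : 3.-tuple R :=
  [tuple (-1) ^+ i.2 * tnth (tnth directions i.1) k | k < 3].

Definition weight (i : 'I_11 * bool) : R := tnth direction_weights i.1.

End Cubature.

(* Main.v *)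
(**
  The cubature is checked on monomials.  In spherical coordinates the moments of
  [sigma] factor into integrals of products of powers of cosines and sines, for
  which integration by parts gives a recurrence.

  For the lower bound, let [x_i], [w_i] be the nodes and weights of a formula of
  degree 7 with [N <= 21] nodes, and let [A] be the space of restrictions of
  cubic forms to the nodes.  The reproducing kernel [K] of the cubic forms gives
  an idempotent matrix [(w_i K(x_i, x_j))] of trace 10, so [dim A = 10].  Odd
  polynomials integrate to 0, so for a linear form [z] without zero among the
  nodes, [zA] is totally isotropic for the form [sum_i (w_i / z(x_i)) f_i g_i],
  and [lA] is contained in [B := (zA)^perp] for every linear form [l].  As [B]
  has dimension [N - 10 <= 11], the quotient [B / zA] is at most a line.  The
  maps [A -> B / zA] induced by the linear forms [l] are pairwise proportional,
  because [f, g |-> sum_i w_i f_i g_i l(x_i) l'(x_i) / z(x_i)] is symmetric in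
  [l, l'].  Hence some [l] not proportional to [z] maps [A] into [zA], which
  forces [K(x_i, x_j) = 0] unless [l / z] takes the same value at [x_i] and
  [x_j], that is unless [x_i], [x_j] and the axis [z x l] are coplanar.

  Varying [z], all pairs of non-parallel nodes with [K(x_i, x_j) <> 0] lie in a
  single plane.  A node [q] outside this plane and not orthogonal to it satisfies
  [K(q, x_i) = 0], that is [(q . x_i)^2] is 0 or 3/7, for the nodes [x_i] of the
  plane, so these span at most three lines, which cubic forms separate; by
  reproduction [K] vanishes also on non-parallel pairs of the plane.  Finally, if
  [K(x_i, x_j) = 0] for all non-parallel pairs, then all weights are 1/20 and
  [(x_i . x_j)^2] is 0, 3/7 or 1, so the second moment reads
  [a + 3 b / 7 = 20 / 3] with natural numbers [a], [b], which is impossible. *)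

Require Import Defs.
From mathcomp Require Import all_boot all_order all_algebra.
From mathcomp Require Import mpoly.
From mathcomp Require Import all_classical all_reals all_analysis.
From mathcomp Require Import measurable_realfun ring lra zify.

Set Implicit Arguments.
Unset Strict Implicit.
Unset Printing Implicit Defensive.

Import Order.TTheory GRing.Theory Num.Theory.
Import numFieldNormedType.Exports.

Local Open Scope classical_set_scope.
Local Open Scope ring_scope.

(** * Integration against the image of a measure with density *)

Section WeightedPushforward.
Local Open Scope ereal_scope.
Context d d' (X : measurableType d) (Y : measurableType d') (R : realType).
Variables (mu : {measure set X -> \bar R}) (nu : {measure set Y -> \bar R}).
Variables (phi : X -> Y) (D : set X) (g : X -> R).
Hypothesis mphi : measurable_fun [set: X] phi.
Hypothesis mD : measurable D.
Hypothesis mg : measurable_fun D g.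
Hypothesis g0 : forall x, D x -> (0 <= g x)%R.
Hypothesis nuE : forall A, measurable A ->
  nu A = \int[mu]_(x in D `&` phi @^-1` A) (g x)%:E.

Import HBNNSimple.

Let mgE : measurable_fun D (EFin \o g).
Proof. exact/measurable_EFinP. Qed.

Let indic_case (A : set Y) : measurable A ->
  \int[mu]_(x in D) ((\1_A (phi x))%:E * (g x)%:E) = nu A.
Proof.
move=> mA; rewrite nuE// integral_mkcondr epatch_indic.
by apply: eq_integral => x _; rewrite muleC.
Qed.

Let nnsfun_case (h : {nnsfun Y >-> R}) :
  \int[mu]_(x in D) ((h (phi x))%:E * (g x)%:E) = \int[nu]_y (h y)%:E.
Proof.
have mind r : measurable_fun [set: X] (fun x => \1_(h @^-1` [set r]) (phi x) : R).
  by apply: measurableT_comp.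
transitivity (\int[nu]_y
   (\sum_(r \in range h) (r * \1_(h @^-1` [set r]) y)%:E)); last first.
  by apply: eq_integral => t _; rewrite /= fimfunE -fsumEFin.
rewrite ge0_integral_fsum//; last 2 first.
- by move=> r; exact/measurable_EFinP/measurableT_comp.
- by move=> r y _; rewrite EFinM nnfun_muleindic_ge0.
transitivity (\int[mu]_(x in D) (\sum_(r \in range h)
    ((r * \1_(h @^-1` [set r]) (phi x))%:E * (g x)%:E))).
  apply: eq_integral => x xD.
  rewrite -ge0_mule_fsuml => [|y]; last by rewrite EFinM nnfun_muleindic_ge0.
  by rewrite fsumEFin// -(fimfunE _ (phi x)).
rewrite ge0_integral_fsum//; last 2 first.
- move=> r; apply: emeasurable_funM => //; apply: measurable_funTS.
  by apply/measurable_EFinP; apply: measurable_funM.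
- by move=> r x Dx; rewrite mule_ge0 ?lee_fin ?g0// -lee_fin EFinM nnfun_muleindic_ge0.
apply: eq_fsbigr => r rh.
under [RHS]eq_integral do rewrite EFinM.
rewrite integralZl_indic_nnsfun// integral_indic// setIT.
under eq_integral do rewrite EFinM -muleA.
rewrite ge0_integralZl//.
- by rewrite indic_case.
- apply: emeasurable_funM => //; apply: measurable_funTS.
  exact/measurable_EFinP.
- by move=> x Dx; rewrite mule_ge0 ?lee_fin ?g0.
- by move: rh; rewrite inE => -[t _ <-]; rewrite lee_fin.
Qed.

Let ge0_case (f : Y -> \bar R) : measurable_fun [set: Y] f ->
  (forall y, 0 <= f y) ->
  \int[nu]_y f y = \int[mu]_(x in D) (f (phi x) * (g x)%:E).
Proof.
move=> mf f0; pose h := nnsfun_approx measurableT mf.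
have fE y : (EFin \o h n) y @[n --> \oo] --> f y.
  exact: cvg_nnsfun_approx.
transitivity (lim (\int[nu]_y (h n y)%:E @[n --> \oo])).
  rewrite -monotone_convergence//=.
  - by apply: eq_integral => y _; apply/esym/cvg_lim => //; exact: fE.
  - by move=> n; exact/measurable_EFinP/measurable_funTS.
  - by move=> n y _; rewrite lee_fin.
  - by move=> y _ a b ab; rewrite lee_fin; exact/lefP/nd_nnsfun_approx.
transitivity (lim (\int[mu]_(x in D) ((h n (phi x))%:E * (g x)%:E) @[n --> \oo])).
  by apply: congr_lim; apply/funext => n; rewrite nnsfun_case.
rewrite -monotone_convergence//=.
- apply: eq_integral => x _; apply/cvg_lim => //.
  by apply: cvgeZr; [|exact: fE].
- move=> n; apply: emeasurable_funM => //; apply: measurable_funTS.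
  by apply/measurable_EFinP; apply: measurableT_comp.
- by move=> n x Dx; rewrite mule_ge0 ?lee_fin ?g0.
- move=> x Dx a b ab; rewrite lee_wpmul2r ?lee_fin ?g0//.
  exact/lefP/nd_nnsfun_approx.
Qed.

(** The usual ladder: indicators, nonnegative simple functions, monotone limits, then positive and
    negative parts. Multiplying by the nonnegative density [g] commutes with taking these parts. *)
Lemma integral_weighted_pushforward (f : Y -> \bar R) :
  measurable_fun [set: Y] f ->
  \int[nu]_y f y = \int[mu]_(x in D) (f (phi x) * (g x)%:E).
Proof.
move=> mf; rewrite integralE [RHS]integralE.
have gE x : x \in D -> 0 <= (g x)%:E by rewrite inE => /g0; rewrite lee_fin.
congr (_ - _).
- rewrite ge0_case//; last exact: measurable_funepos.
  apply: eq_integral => x /gE gx; rewrite !funeposE.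
  by rewrite maxe_pMl// mul0e.
- rewrite ge0_case//; last exact: measurable_funeneg.
  apply: eq_integral => x /gE gx; rewrite !funenegE.
  by rewrite maxe_pMl// mul0e mulNe.
Qed.

End WeightedPushforward.

(** * Integrals over the sphere in spherical coordinates *)

Section SphereMoments.
Variable R : realType.
Local Notation mu := (@lebesgue_measure R).
Local Notation mu2 := ((@lebesgue_measure R) \x (@lebesgue_measure R))%E.
Implicit Types (f : 3.-tuple R -> R) (T : R) (a b i j k : nat).

Lemma measurable_S2 : measurable (@S2 R).
Proof.
have mf : measurable_fun [set: 3.-tuple R] (fun v => \sum_(i < 3) tnth v i ^+ 2).
  apply: measurable_sum => i; apply: measurable_funX.
  exact: measurable_tnth.
have := mf measurableT [set 1] (measurable_set1 _).
by rewrite setTI.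
Qed.

Lemma integral_sigma f : measurable_fun [set: 3.-tuple R] f ->
  (\int[@sigma R]_(v in @S2 R) (f v)%:E =
   \int[mu2]_(p in @angles R)
     (f (spherical p) * ((4 * pi)^-1 * sin p.1))%:E)%E.
Proof.
move=> mf; rewrite integral_mkcond.
rewrite (@integral_weighted_pushforward _ _ _ _ _ mu2 _ (@spherical R)
  (@angles R) (fun p => (4 * pi)^-1 * sin p.1)) //.
- apply: eq_integral => p _; rewrite patchE ifT ?EFinM// inE.
  exact: spherical_S2.
- exact: measurable_spherical.
- exact: measurable_angles.
- apply: measurable_funM => //; apply: measurable_funTS.
  by have /measurable_EFinP := @measurable_sin1 R.
- move=> p /sin_angles_ge0; rewrite lee_fin => ?.
  by rewrite mulr_ge0// inv4pi_ge0.
- move=> A mA; transitivity (((4 * pi)^-1)%:E * surface_area A)%E; first by [].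
  rewrite /surface_area; under [RHS]eq_integral do rewrite EFinM.
  rewrite ge0_integralZl//.
  + exact: angles_preimage.
  + by apply: measurable_funTS; exact: measurable_sin1.
  + by move=> p [/sin_angles_ge0].
  + by rewrite lee_fin inv4pi_ge0.
- apply/(measurable_restrictT _ measurable_S2); apply: measurable_funTS.
  exact/measurable_EFinP.
Qed.

Lemma mu2_angles_lty : (mu2 (@angles R) < +oo)%E.
Proof.
rewrite /angles product_measure1E//= !lebesgue_measure_itv/= !lte_fin.
by rewrite mulr_gt0 ?pi_gt0// -EFinM ltry.
Qed.

(** Fubini on a rectangle; the bound 1 on both factors yields integrability, the rectangle having
    finite measure. *)
Lemma integral_angles_prod (f g : R -> R) :
  measurable_fun [set: R] f -> measurable_fun [set: R] g ->
  (forall x, `|f x| <= 1) -> (forall x, `|g x| <= 1) ->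
  mu2.-integrable (@angles R) (EFin \o (fun p => f p.1 * g p.2)) /\
  (\int[mu2]_(p in @angles R) (f p.1 * g p.2) =
   (\int[mu]_(x in `[0%R, pi]) f x) * (\int[mu]_(x in `[0%R, (2 * pi)%R]) g x))%R.
Proof.
move=> mf mg f1 g1.
have bnd (h : R -> R) (c : R) : measurable_fun [set: R] h ->
    (forall x, `|h x| <= 1) -> mu.-integrable `[0%R, c] (EFin \o h).
  move=> mh h1; apply: measurable_bounded_integrable => //.
  - rewrite /= lebesgue_measure_itv/=; by case: ifP => _; rewrite -?EFinB ltry.
  - exact: measurable_funTS.
  - exists 1; split => // y y1 x _ /=; exact: le_trans (h1 x) (ltW y1).
have ifg : mu2.-integrable (@angles R) (EFin \o (fun p => f p.1 * g p.2)).
  apply: measurable_bounded_integrable.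
  - exact: measurable_angles.
  - exact: mu2_angles_lty.
  - apply: measurable_funTS; apply: measurable_funM.
      exact: measurableT_comp.
    exact: measurableT_comp.
  - exists 1; split => // y y1 p _ /=; rewrite normrM.
    by apply: le_trans (ltW y1); rewrite mulr_ile1.
split=> //; rewrite /Rintegral -fineM; last 2 first.
  1,2: by apply: integrable_fin_num => //; exact: bnd.
congr fine; rewrite integral_mkcond -integral12_prod_meas1; last first.
  by apply: (proj1 (integrable_mkcond _ _) ifg); exact: measurable_angles.
rewrite /fubini_F (_ : (fun x => _) =
    (fun x => (f x)%:E * \int[mu]_(y in `[0%R, (2 * pi)%R]) (g y)%:E)%E \_ `[0, pi]);
    last first.
  apply/funext => x; rewrite patchE; case: ifPn => [xI|xI].
    rewrite -integralZl//; last exact: bnd.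
    rewrite [RHS]integral_mkcond; apply: eq_integral => y _.
    rewrite !patchE /=; have -> : ((x, y) \in @angles R) = (y \in `[0%R, (2 * pi)%R]%classic).
      apply/idP/idP; rewrite !inE /angles /=; first by case.
      by split=> //; rewrite inE in xI.
    by [].
  rewrite -[RHS](@integral0 _ _ _ mu setT).
  apply: eq_integral => y _; rewrite patchE; case: ifPn => //.
  by rewrite inE /angles /= => -[x1 _]; rewrite notin_setE in xI.
rewrite -integral_mkcond; set G := (\int[mu]_(y in _) (g y)%:E)%E.
have /fineK <- : G \is a fin_num by apply: integrable_fin_num => //; exact: bnd.
by rewrite integralZr//; exact: bnd.
Qed.

End SphereMoments.

(** * Integrals of products of powers of cosine and sine *)

Section Trigonometric.
Variable R : realType.
Local Notation mu := (@lebesgue_measure R).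
Implicit Types (T : R) (a b : nat).

Definition trigint T a b : R :=
  \int[mu]_(x in `[0, T]) (cos x ^+ a * sin x ^+ b).

(** At exponent 0 the truncated predecessor is harmless, because its term carries the factor 0. *)
Lemma is_derive_trig a b (x : R) :
  is_derive x 1 (fun x => cos x ^+ a * sin x ^+ b)
    (b%:R * (cos x ^+ a.+1 * sin x ^+ b.-1) -
     a%:R * (cos x ^+ a.-1 * sin x ^+ b.+1)).
Proof.
rewrite (_ : (fun x => _) = (@cos R ^+ a) * (@sin R ^+ b)); last first.
  by rewrite !exprfctE mulrfctE.
apply: is_derive_eq; rewrite !exprfctE !exprS /GRing.scale/=; ring.
Qed.

Lemma continuous_trig a b : continuous (fun x : R => cos x ^+ a * sin x ^+ b).
Proof.
move=> x; apply: differentiable_continuous; apply/derivable1_diffP.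
by have [] := is_derive_trig a b x.
Qed.

Lemma measurable_trig a b :
  measurable_fun [set: R] (fun x : R => cos x ^+ a * sin x ^+ b).
Proof. apply: continuous_measurable_fun; exact: continuous_trig. Qed.

Lemma trig_le1 a b (x : R) : `|cos x ^+ a * sin x ^+ b| <= 1.
Proof.
by rewrite normrM !normrX mulr_ile1 ?exprn_ge0 ?exprn_ile1 ?cos_max ?sin_max.
Qed.

Lemma integrable_trig T a b :
  mu.-integrable `[0, T] (EFin \o (fun x => cos x ^+ a * sin x ^+ b)).
Proof.
apply: measurable_bounded_integrable => //.
- by rewrite /= lebesgue_measure_itv/=; case: ifP => _; rewrite -?EFinB ltry.
- apply: measurable_funTS; exact: measurable_trig.
- exists 1; split => // y y1 x _ /=; exact: le_trans (trig_le1 _ _ _) (ltW y1).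
Qed.

Lemma trigint_pythagoras T a b :
  trigint T a.+2 b + trigint T a b.+2 = trigint T a b.
Proof.
rewrite /trigint -RintegralD//; try exact: integrable_trig.
congr fine; apply: eq_integral => x _; congr EFin.
by rewrite -[RHS]mul1r -(cos2Dsin2 x) !exprS; ring.
Qed.

Lemma trigint_parts T a b : 0 < T ->
  b%:R * trigint T a.+1 b.-1 - a%:R * trigint T a.-1 b.+1 =
  cos T ^+ a * sin T ^+ b - cos 0 ^+ a * sin 0 ^+ b.
Proof.
move=> T0; rewrite /trigint -!RintegralZl//; try exact: integrable_trig.
have iZ (r : R) m n : mu.-integrable `[0, T]
    (EFin \o (fun x => r * (cos x ^+ m * sin x ^+ n))).
  exact: integrableZl (integrable_trig T m n).
rewrite -RintegralB// /Rintegral.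
rewrite (@continuous_FTC2 _ _ (fun x => cos x ^+ a * sin x ^+ b))//.
- apply: continuous_subspaceT => x; apply: cvgB;
    apply: cvgM (@continuous_trig _ _ _); exact: cvg_cst.
- split.
  + by move=> x _; have [] := is_derive_trig a b x.
  + exact/cvg_at_right_filter/continuous_trig.
  + exact/cvg_at_left_filter/continuous_trig.
- by move=> x _; rewrite derive1E; have [] := is_derive_trig a b x.
Qed.

Lemma trigint_cosSS T a b : 0 < T -> sin T = 0 ->
  (a + b).+2%:R * trigint T a.+2 b = a.+1%:R * trigint T a b.
Proof.
move=> T0 sT; have := trigint_parts a.+1 b.+1 T0.
rewrite sT sin0 /= !exprS !mul0r !mulr0 subrr => /eqP; rewrite subr_eq0.
move=> /eqP E; rewrite -(trigint_pythagoras T a b) mulrDr -E -mulrDl -natrD.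
by rewrite addSn addnS.
Qed.

Lemma trigint_sinSS T a b : 0 < T -> sin T = 0 ->
  (a + b).+2%:R * trigint T a b.+2 = b.+1%:R * trigint T a b.
Proof.
move=> T0 sT; have := trigint_parts a.+1 b.+1 T0.
rewrite sT sin0 /= !exprS !mul0r !mulr0 subrr => /eqP; rewrite subr_eq0.
move=> /eqP E; rewrite -(trigint_pythagoras T a b) mulrDr E -mulrDl -natrD.
by rewrite addSn addnS addnC.
Qed.

Lemma trigint_cos_odd T a b : 0 < T -> sin T = 0 -> odd a -> trigint T a b = 0.
Proof.
move=> T0 sT; elim/ltn_ind: a => -[|[|a]]//= IH oa.
  have := trigint_parts 0 b.+1 T0.
  rewrite sT sin0 !exprS !mul0r !mulr0 subrr subr0 => /eqP.
  by rewrite mulf_eq0 pnatr_eq0 => /eqP.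
have := trigint_cosSS a b T0 sT; rewrite (IH a)//; last by rewrite -[odd a]negbK.
by move/eqP; rewrite mulr0 mulf_eq0 pnatr_eq0 => /eqP.
Qed.

Lemma trigint2pi_sin_odd a b : odd b -> trigint (2 * pi) a b = 0.
Proof.
have T0 : 0 < 2 * pi :> R by rewrite mulr_gt0 ?pi_gt0.
have sT : sin (2 * pi) = 0 :> R by rewrite mulr_natl sin2pi.
elim/ltn_ind: b => -[|[|b]]//= IH ob.
  have := trigint_parts a.+1 0 T0; rewrite mul0r sub0r !expr0 !mulr1.
  rewrite [in cos (2 * pi)]mulr_natl cos2pi cos0 subrr => /eqP.
  by rewrite oppr_eq0 mulf_eq0 pnatr_eq0 => /eqP.
have := trigint_sinSS a b T0 sT; rewrite (IH b)//; last by rewrite -[odd b]negbK.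
by move/eqP; rewrite mulr0 mulf_eq0 pnatr_eq0 => /eqP.
Qed.

Lemma trigint00 T : 0 < T -> trigint T 0 0 = T.
Proof.
move=> T0; rewrite /trigint.
under eq_Rintegral do rewrite !expr0 mulr1.
by rewrite Rintegral_cst// /= lebesgue_measure_itv/= lte_fin T0 /= subr0 mul1r.
Qed.

Lemma trigint_pi01 : trigint pi 0 1 = 2.
Proof.
have := trigint_parts 1 0 (pi_gt0 R).
by rewrite mul0r sub0r mul1r !expr0 !mulr1 !expr1 cospi cos0 => /eqP;
  rewrite -opprD eqr_opp => /eqP ->.
Qed.

End Trigonometric.

Lemma big_ord3 (T : Type) (idx : T) (op : Monoid.law idx) (F : 'I_3 -> T) :
  \big[op/idx]_(i < 3) F i = op (F ord0) (op (F 1) (F 2)).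
Proof.
rewrite !big_ord_recl big_ord0 Monoid.mulm1.
by congr (op _ (op (F _) (F _))); exact: val_inj.
Qed.

(** * Monomial moments of the sphere *)

Section SphereMoments.
Variable R : realType.
Local Notation mu := (@lebesgue_measure R).
Local Notation mu2 := ((@lebesgue_measure R) \x (@lebesgue_measure R))%E.
Implicit Types (i j k : nat) (f : {mpoly R[3]}).

(** The polar integral times the azimuthal one; the area element contributes the extra power of sine
    in the former. *)
Definition sphere_moment i j k : R :=
  (4 * pi)^-1 * (trigint pi k (i + j).+1 * trigint (2 * pi) i j).

Let pi2_gt0 : 0 < 2 * pi :> R.
Proof. by rewrite mulr_gt0 ?pi_gt0. Qed.

Let sin2pi0 : sin (2 * pi) = 0 :> R.
Proof. by rewrite mulr_natl sin2pi. Qed.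

Lemma sphere_moment000 : sphere_moment 0 0 0 = 1.
Proof.
rewrite /sphere_moment trigint00// trigint_pi01.
rewrite (_ : 2 * (2 * pi) = 4 * pi); last by ring.
by rewrite mulVf// gt_eqF// mulr_gt0 ?pi_gt0.
Qed.

Lemma sphere_moment_odd i j k : [|| odd i, odd j | odd k] ->
  sphere_moment i j k = 0.
Proof.
rewrite /sphere_moment => /or3P[oi|oj|ok].
- by rewrite [trigint (2 * pi) _ _]trigint_cos_odd// !mulr0.
- by rewrite trigint2pi_sin_odd// !mulr0.
- by rewrite [trigint pi _ _]trigint_cos_odd ?pi_gt0 ?sinpi// mul0r mulr0.
Qed.

(** Raising [i] by 2 raises a power of sine in the polar integral and a power of cosine in the
    azimuthal one; the factor [(i + j).+2] appears in both recurrences and cancels. *)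
Lemma sphere_momentSS1 i j k :
  sphere_moment i.+2 j k = i.+1%:R / (i + j + k).+3%:R * sphere_moment i j k.
Proof.
have N0 : (i + j + k).+3%:R != 0 :> R by rewrite pnatr_eq0.
have M0 : (i + j).+2%:R != 0 :> R by rewrite pnatr_eq0.
have := trigint_cosSS i j pi2_gt0 sin2pi0.
have := trigint_sinSS k (i + j).+1 (pi_gt0 R) (sinpi R).
rewrite /sphere_moment !addSn !addnS (addnC k).
move: N0 M0; move: (i + j + k).+3%:R (i + j).+2%:R => N M N0 M0 E1 E2.
apply: (mulfI (mulf_neq0 M0 N0)); set c := _^-1.
transitivity (c * (N * trigint pi k (i + j).+3 *
              (M * trigint (2 * pi) i.+2 j))); first by ring.
by rewrite E1 E2; field.
Qed.

Lemma sphere_momentSS2 i j k :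
  sphere_moment i j.+2 k = j.+1%:R / (i + j + k).+3%:R * sphere_moment i j k.
Proof.
have N0 : (i + j + k).+3%:R != 0 :> R by rewrite pnatr_eq0.
have M0 : (i + j).+2%:R != 0 :> R by rewrite pnatr_eq0.
have := trigint_sinSS i j pi2_gt0 sin2pi0.
have := trigint_sinSS k (i + j).+1 (pi_gt0 R) (sinpi R).
rewrite /sphere_moment !addnS (addnC k).
move: N0 M0; move: (i + j + k).+3%:R (i + j).+2%:R => N M N0 M0 E1 E2.
apply: (mulfI (mulf_neq0 M0 N0)); set c := _^-1.
transitivity (c * (N * trigint pi k (i + j).+3 *
              (M * trigint (2 * pi) i j.+2))); first by ring.
by rewrite E1 E2; field.
Qed.

Lemma sphere_momentSS3 i j k :
  sphere_moment i j k.+2 = k.+1%:R / (i + j + k).+3%:R * sphere_moment i j k.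
Proof.
have N0 : (i + j + k).+3%:R != 0 :> R by rewrite pnatr_eq0.
have := trigint_cosSS k (i + j).+1 (pi_gt0 R) (sinpi R).
rewrite /sphere_moment !addnS (addnC k).
move: N0; move: (i + j + k).+3%:R => N N0 E1.
apply: (mulfI N0); set c := _^-1.
transitivity (c * (N * trigint pi k.+2 (i + j).+1 *
              trigint (2 * pi) i j)); first by ring.
by rewrite E1; field.
Qed.

Lemma integral_sigma_mpoly f :
  (\int[@sigma R]_(v in @S2 R) (f.@[tnth v])%:E =
   (\sum_(m <- msupp f) f@_m *
      sphere_moment (m ord0) (m 1) (m 2))%:E)%E.
Proof.
have mf : measurable_fun [set: 3.-tuple R] (fun v => f.@[tnth v]).
  under eq_fun do rewrite mevalE.
  apply: measurable_sum => m; apply: measurable_funM => //.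
  apply: measurable_prod => i _; apply: measurable_funX.
  exact: measurable_tnth.
rewrite integral_sigma//.
pose A (m : 'X_{1..3}) := fun x : R => cos x ^+ m 2 * sin x ^+ (m ord0 + m 1).+1.
pose B (m : 'X_{1..3}) := fun x : R => cos x ^+ m ord0 * sin x ^+ m 1.
have iAB (m : 'X_{1..3}) := integral_angles_prod
  (@measurable_trig R (m 2) (m ord0 + m 1).+1)
  (@measurable_trig R (m ord0) (m 1)) (@trig_le1 _ _ _) (@trig_le1 _ _ _).
transitivity (\int[mu2]_(p in @angles R) (\sum_(m <- msupp f)
    (f@_m / (4 * pi))%:E * (A m p.1 * B m p.2)%:E))%E.
  apply: eq_integral => p _; under [RHS]eq_bigr do rewrite -EFinM.
  rewrite sumEFin mevalE mulr_suml; congr EFin; apply: eq_bigr => m _.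
  rewrite big_ord3 /A /B !(tnth_nth 0) /= !exprMn !exprS exprD; ring.
rewrite integral_sum//; last 2 first.
- exact: measurable_angles.
- by move=> m; apply: integrableZl => //; [exact: measurable_angles|case: (iAB m)].
rewrite -sumEFin; apply: eq_bigr => m _; have [im Em] := iAB m.
rewrite integralZl//; last exact: measurable_angles.
rewrite -(fineK (integrable_fin_num _ im))//; last exact: measurable_angles.
rewrite -EFinM; congr EFin.
by rewrite [X in _ * X]Em /sphere_moment /trigint; ring.
Qed.
End SphereMoments.

(** * Monomial moments of the explicit nodes *)

Section Nodes.
Variable R : realType.
Implicit Types (i j k : nat) (F : 3.-tuple R -> R).

Lemma sum_nodes F :
  \sum_n weight R n * F (node R n) =
  \sum_(d < 11) tnth (direction_weights R) d *
    (F (node R (d, false)) + F (node R (d, true))).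
Proof.
transitivity (\sum_(d < 11) \sum_b weight R (d, b) * F (node R (d, b))).
  by rewrite pair_bigA; apply: eq_bigr => -[].
by apply: eq_bigr => d _; rewrite big_bool /weight /= mulrDr addrC.
Qed.

Definition monomial3 i j k (v : 3.-tuple R) : R :=
  tnth v ord0 ^+ i * (tnth v 1 ^+ j * tnth v 2 ^+ k).

Let tnth_false d l : tnth (node R (d, false)) l = tnth (tnth (directions R) d) l.
Proof. by rewrite tnth_mktuple expr0 mul1r. Qed.

Let tnth_true d l : tnth (node R (d, true)) l = - tnth (tnth (directions R) d) l.
Proof. by rewrite tnth_mktuple expr1 mulN1r. Qed.

Lemma sum_nodes_monomial i j k :
  \sum_n weight R n * monomial3 i j k (node R n) =
  (1 + (-1) ^+ (i + j + k)) *
  \sum_(d < 11) tnth (direction_weights R) d *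
    monomial3 i j k (tnth (directions R) d).
Proof.
rewrite sum_nodes mulr_sumr; apply: eq_bigr => d _.
rewrite /monomial3 !tnth_false !tnth_true ![(- tnth _ _) ^+ _]exprNn !exprD.
ring.
Qed.

Lemma sum_directions F :
  \sum_(d < 11) tnth (direction_weights R) d * F (tnth (directions R) d) =
  1 / 20 * (F (vec3 1 0 0) + F (vec3 0 1 0)) + 1 / 27 * F (vec3 0 0 1) +
  49 / 1080 * \sum_(v <- drop 3 (directions R)) F v.
Proof.
transitivity (\sum_(0 <= d < 11)
    nth 0 (direction_weights R) d * F (nth (vec3 0 0 0) (directions R) d)).
  by rewrite big_mkord; apply: eq_bigr => d _; rewrite -!tnth_nth.
rewrite big_ltn// big_ltn// big_ltn// /= mulrDr -!addrA; congr (_ + (_ + (_ + _))).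
rewrite mulr_sumr. by rewrite unlock.
Qed.

Lemma sum_nodes_moment i j k : (i + j + k <= 7)%N ->
  \sum_n weight R n * monomial3 i j k (node R n) = sphere_moment R i j k.
Proof.
move=> le7; rewrite sum_nodes_monomial.
have [oijk|eijk] := boolP (odd (i + j + k)).
  rewrite -signr_odd oijk expr1 subrr mul0r sphere_moment_odd//.
  by move: oijk; rewrite !oddD; case: (odd i); case: (odd j); case: (odd k).
rewrite -signr_odd (negbTE eijk) expr0 sum_directions /=.
rewrite !big_cons big_nil /monomial3 !(tnth_nth 0) /= !mul0r !mulNr.
set A := Num.sqrt 3 / _; set B := 1 / Num.sqrt _; set C := 2 / Num.sqrt _.
(* The degree is even, so if some exponent is odd, exactly two are: each term then contains an odd
   power of 0 or cancels against the term with one sign changed. *)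
have [odds|evens] := boolP ([|| odd i, odd j | odd k]).
  rewrite sphere_moment_odd// !(exprNn A) !(exprNn B) !(exprNn C).
  rewrite -!(signr_odd _ j) -!(signr_odd _ k).
  rewrite !expr1n !expr0n.
  move: (A ^+ i) (A ^+ j) (B ^+ k) (C ^+ k) => a b c c'.
  have ne0 l : odd l -> (l == 0%N) = false by case: l.
  move: eijk odds; rewrite !oddD.
  case oi : (odd i); case oj : (odd j); case ok : (odd k) => //= _ _;
  rewrite ?(ne0 _ oi) ?(ne0 _ oj) ?(ne0 _ ok) ?expr0 ?expr1 /=; ring.
have sqr7 (x y : R) : (x / Num.sqrt y) ^+ 2 = x ^+ 2 / Num.sqrt y ^+ 2.
  by rewrite expr_div_n.
have A2 : A ^+ 2 = 3 / 7 by rewrite sqr7 !sqr_sqrtr.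
have B2 : B ^+ 2 = 1 / 7 by rewrite sqr7 !sqr_sqrtr// expr1n.
have C2 : C ^+ 2 = 4 / 7 by rewrite sqr7 !sqr_sqrtr//; congr (_ / _); ring.
have half l : ~~ odd l -> l = (2 * l./2)%N.
  by move=> el; rewrite -[LHS]odd_double_half (negbTE el) add0n mul2n.
(* With all exponents even only the rational squares of the coordinates enter, and the halved
   exponents sum to at most 3, which leaves finitely many checks. *)
move: evens le7; rewrite !negb_or => /and3P[/half -> /half -> /half ->].
move: i./2 j./2 k./2 => {eijk}i {}j {}k le7.
rewrite !exprM !sqrrN !A2 !B2 !C2 expr1n expr0n /=.
have : (i + j + k <= 3)%N by lia.
case: i le7 => [|[|[|[|i]]]] _; case: j => [|[|[|[|j]]]]; case: k => [|[|[|[|k]]]];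
  rewrite ?addSn ?addnS// => _; rewrite !mul2n ?doubleS ?double0
    ?(sphere_momentSS1, sphere_momentSS2, sphere_momentSS3) sphere_moment000;
  by field.
Qed.

End Nodes.

(** * The explicit nodes form a cubature formula of degree seven *)

Section NodeCubature.
Variable R : realType.

Let sqrt_gt0 (n : nat) : 0 < Num.sqrt n.+1%:R :> R.
Proof. by rewrite sqrtr_gt0. Qed.

Let sqr_sqrt (n : nat) : Num.sqrt n%:R ^+ 2 = n%:R :> R.
Proof. by rewrite sqr_sqrtr. Qed.

(** The sign pattern read in balanced ternary. It changes sign under the antipode, and its absolute
    values on the eleven directions are distinct, so it separates the nodes. *)
Let ternary_code (v : 3.-tuple R) : R :=
  Num.sg (tnth v ord0) + 3 * Num.sg (tnth v 1) + 9 * Num.sg (tnth v 2).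

Let codes : seq int := [:: 1; 3; 9; 10; - 8; 12; - 6; 13; - 5; 7; - 11].

Let code_node d b :
  ternary_code (node R (d, b)) = (-1) ^+ b * (nth 0 codes d)%:~R.
Proof.
rewrite /ternary_code !tnth_mktuple !sgrM sgrX sgrN1.
rewrite (mulrCA 3) (mulrCA 9) -!mulrDr; congr (_ * _).
have sg7 (x : R) : Num.sg (x / Num.sqrt 7) = Num.sg x.
  by rewrite sgrM sgrV (gtr0_sg (sqrt_gt0 6)) mulr1.
have sg3 : Num.sg (Num.sqrt 3 : R) = 1 := gtr0_sg (sqrt_gt0 2).
have sg2 : Num.sg (2 : R) = 1 by rewrite gtr0_sg.
case: d => -[|[|[|[|[|[|[|[|[|[|[|//]]]]]]]]]]] d;
  rewrite !(tnth_nth (vec3 0 0 0)) !(tnth_nth 0) /= ?sg7 ?sgrN ?sg3 ?sg2 ?sgr0 ?sgr1; ring.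
Qed.

Lemma node_inj : injective (@node R).
Proof.
move=> [d b] [d' b'] /(congr1 ternary_code); rewrite !code_node => E.
have dd' : d = d'.
  have /eqP := congr1 (@Num.norm _ R) E.
  rewrite !normrMsign -!intr_norm eqr_int => /eqP {}E.
  have u : uniq (map Num.norm codes) by [].
  have sz e : (e < 11)%N -> (e < size (map Num.norm codes))%N by [].
  apply/val_inj/eqP; rewrite -(nth_uniq 0 (sz _ (ltn_ord d)) (sz _ (ltn_ord d')) u).
  by rewrite !(nth_map 0) ?E.
rewrite {}dd' in E *; congr pair.
have c0 : (nth 0 codes d')%:~R != 0 :> R.
  by rewrite intr_eq0; case: d' {E} => -[|[|[|[|[|[|[|[|[|[|[|//]]]]]]]]]]].
exact/(@signr_inj R)/(mulIf c0 E).
Qed.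

Lemma node_S2 n : S2 (node R n).
Proof.
have sq7 (x : R) : (x / Num.sqrt 7) ^+ 2 = x ^+ 2 / 7.
  by rewrite expr_div_n sqr_sqrt.
case: n => d b; rewrite /S2/= big_ord3 !tnth_mktuple !exprMn sqrr_sign !mul1r.
case: d => -[|[|[|[|[|[|[|[|[|[|[|//]]]]]]]]]]] d;
  rewrite !(tnth_nth (vec3 0 0 0)) !(tnth_nth 0) /= ?sq7 ?sqrrN ?sqr_sqrt;
  by field.
Qed.

Lemma weight_gt0 n : 0 < weight R n.
Proof.
rewrite /weight; case: n => -[[|[|[|[|[|[|[|[|[|[|[|//]]]]]]]]]]] d] b;
  rewrite (tnth_nth 0) /=; lra.
Qed.

Lemma node_cubature : positive_cubature 7 (@node R) (@weight R).
Proof.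
split; [exact: node_inj|exact: node_S2|exact: weight_gt0|].
move=> f f7; rewrite integral_sigma_mpoly; congr EFin.
under [RHS]eq_bigr do rewrite mevalE mulr_sumr.
rewrite exchange_big /=; apply: eq_big_seq => m mf.
rewrite -sum_nodes_moment; last first.
  have := leq_trans (msize_mdeg_lt mf) f7; rewrite mdegE big_ord3.
  by rewrite ltnS /= addnA.
rewrite mulr_sumr; apply: eq_bigr => n _.
by rewrite big_ord3 /monomial3 mulrCA.
Qed.

End NodeCubature.

(** * The reproducing kernel of cubic forms under a formula of degree seven *)

Section Kernel.
Variable R : realType.
Implicit Types (u v y z a b c : 3.-tuple R) (F G : 3.-tuple R -> R).

Definition dot u v : R :=
  tnth u ord0 * tnth v ord0 + (tnth u 1 * tnth v 1 + tnth u 2 * tnth v 2).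

(* On unit vectors this is [3 P_1 + 7 P_3] at [dot u v], the reproducing kernel of
   the cubic forms, with [P_1], [P_3] the Legendre polynomials. *)
Definition cubic_kernel u v : R :=
  dot u v * (35 / 2 * dot u v ^+ 2 - 15 / 2 * (dot u u * dot v v)).

Definition opp3 v : 3.-tuple R := vec3 (- tnth v ord0) (- tnth v 1) (- tnth v 2).

Lemma dotC u v : dot u v = dot v u.
Proof. by rewrite /dot; ring. Qed.

Lemma dotNr u v : dot u (opp3 v) = - dot u v.
Proof. by rewrite /dot /opp3 !(tnth_nth 0) /=; ring. Qed.

Lemma cubic_kernelC u v : cubic_kernel u v = cubic_kernel v u.
Proof. by rewrite /cubic_kernel dotC; ring. Qed.

Lemma cubic_kernelNr u v : cubic_kernel u (opp3 v) = - cubic_kernel u v.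
Proof. by rewrite /cubic_kernel !dotNr (dotC (opp3 v) v) dotNr; ring. Qed.

Lemma S2_dot v : S2 v <-> dot v v = 1.
Proof. by rewrite /S2/= big_ord3 /dot !expr2. Qed.

Definition polyfun d F :=
  exists2 p : {mpoly R[3]}, (msize p <= d.+1)%N & forall v, F v = p.@[tnth v].

Lemma polyfun_cst (r : R) : polyfun 0 (cst r).
Proof.
exists r%:MP; first by rewrite msizeC leq_b1.
by move=> v; rewrite mevalC.
Qed.

Lemma polyfun_coord (l : 'I_3) : polyfun 1 (fun v => tnth v l).
Proof. by exists 'X_l => [|v]; rewrite ?msizeX ?mdeg1 ?mevalXU. Qed.

Lemma polyfunD d F G :
  polyfun d F -> polyfun d G -> polyfun d (fun v => F v + G v).
Proof.
move=> [p sp pE] [q sq qE]; exists (p + q) => [|v].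
  by rewrite (leq_trans (msizeD_le _ _))// geq_max sp.
by rewrite mevalD pE qE.
Qed.

Lemma polyfunM d e F G :
  polyfun d F -> polyfun e G -> polyfun (d + e) (fun v => F v * G v).
Proof.
move=> [p sp pE] [q sq qE]; exists (p * q) => [|v]; last by rewrite mevalM pE qE.
have [->|p0] := eqVneq p 0; first by rewrite mul0r msize0.
have [->|q0] := eqVneq q 0; first by rewrite mulr0 msize0.
rewrite msizeM//; move: sp sq; move: (mmeasure _ p) (mmeasure _ q) => m n.
by lia.
Qed.

Lemma polyfun_monomial3 i j k : polyfun (i + (j + k)) (monomial3 i j k).
Proof.
have polyX (l : 'I_3) n : polyfun n (fun v => tnth v l ^+ n).
  elim: n => [|n IHn]; first exact: polyfun_cst.
  under [X in polyfun _ X]eq_fun do rewrite exprS.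
  exact: polyfunM (polyfun_coord l) IHn.
by do 2?apply: polyfunM.
Qed.

Lemma polyfun_dot u : polyfun 1 (dot u).
Proof.
have polyC l : polyfun 1 (fun v => tnth u l * tnth v l).
  exact: (polyfunM (polyfun_cst (tnth u l)) (polyfun_coord l)).
by do 2?apply: polyfunD.
Qed.

Lemma polyfun_kernel u : polyfun 3 (cubic_kernel u).
Proof.
apply: (polyfunM (polyfun_dot u)).
have dot2 : polyfun 2 (fun v => dot v v).
  have sqr l : polyfun 2 (fun v => tnth v l * tnth v l).
    exact: polyfunM (polyfun_coord l) (polyfun_coord l).
  by do 2?apply: polyfunD.
have := polyfunD
  (polyfunM (polyfun_cst (35 / 2)) (polyfunM (polyfun_dot u) (polyfun_dot u)))
  (polyfunM (polyfun_cst (- (15 / 2) * dot u u)) dot2).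
congr (polyfun _ _); apply/funext => v; rewrite /cst; ring.
Qed.

Section Cubature.
Variables (I : finType) (x : I -> 3.-tuple R) (w : I -> R).
Hypothesis cub : positive_cubature 7 x w.

(** Both formulas compute the same integral, so parity and moments can be read off the explicit
    nodes. *)
Let cub_nodes F : polyfun 7 F ->
  \sum_i w i * F (x i) = \sum_n weight R n * F (node R n).
Proof.
move=> [p sp pE]; have [_ _ _ /(_ p sp) E1] := cub.
have [_ _ _ /(_ p sp)] := node_cubature R; rewrite E1 => -[E].
by under eq_bigr do rewrite pE; rewrite E; apply: eq_bigr => n _; rewrite pE.
Qed.

Lemma cubature_odd F : polyfun 7 F -> (forall v, F (opp3 v) = - F v) ->
  \sum_i w i * F (x i) = 0.
Proof.
move=> pF oF; rewrite cub_nodes// sum_nodes big1// => d _.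
rewrite (_ : node R (d, true) = opp3 (node R (d, false))).
  by rewrite oF addrN mulr0.
apply: eq_from_tnth => l; rewrite tnth_mktuple /opp3 !tnth_mktuple /=.
rewrite expr0 expr1 !mul1r mulN1r.
by case: l => -[|[|[|//]]] l; rewrite [in RHS](tnth_nth 0) /=;
  congr (- tnth _ _); apply: val_inj.
Qed.

Lemma cubature_moment i j k : (i + j + k <= 7)%N ->
  \sum_n w n * monomial3 i j k (x n) = sphere_moment R i j k.
Proof.
move=> le7; rewrite cub_nodes ?sum_nodes_moment//.
have [p sp pE] := polyfun_monomial3 i j k; exists p => //.
by rewrite (leq_trans sp)// ltnS addnA.
Qed.

Let E i j k := \sum_n w n * monomial3 i j k (x n).

Let kernel_expand y i j k :
  \sum_n w n * (cubic_kernel y (x n) * monomial3 i j k (x n)) =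
  let y0 := tnth y ord0 in let y1 := tnth y 1 in let y2 := tnth y 2 in
  35 / 2 * (y0 ^+ 3 * E i.+3 j k + y1 ^+ 3 * E i j.+3 k + y2 ^+ 3 * E i j k.+3 +
    3 * y0 ^+ 2 * y1 * E i.+2 j.+1 k + 3 * y0 ^+ 2 * y2 * E i.+2 j k.+1 +
    3 * y1 ^+ 2 * y0 * E i.+1 j.+2 k + 3 * y1 ^+ 2 * y2 * E i j.+2 k.+1 +
    3 * y2 ^+ 2 * y0 * E i.+1 j k.+2 + 3 * y2 ^+ 2 * y1 * E i j.+1 k.+2 +
    6 * y0 * y1 * y2 * E i.+1 j.+1 k.+1) +
  - 15 / 2 * dot y y * (y0 * (E i.+3 j k + E i.+1 j.+2 k + E i.+1 j k.+2) +
    y1 * (E i.+2 j.+1 k + E i j.+3 k + E i j.+1 k.+2) +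
    y2 * (E i.+2 j k.+1 + E i j.+2 k.+1 + E i j k.+3)).
Proof.
cbv zeta; rewrite /E !(mulr_sumr, =^~ big_split) /=.
apply: eq_bigr => n _; rewrite /cubic_kernel /monomial3 /dot !exprS.
by ring.
Qed.

Let E6 i j k : (i + j + k <= 7)%N -> E i j k = sphere_moment R i j k.
Proof. exact: cubature_moment. Qed.

(** The kernel is kept homogeneous, so every moment in [kernel_expand] has degree 6 and its value is
    known; only the ten cubic monomials have to be checked. *)
Let kernel_monomial y i j k : (i + j + k)%N = 3 ->
  \sum_n w n * (cubic_kernel y (x n) * monomial3 i j k (x n)) = monomial3 i j k y.
Proof.
move=> e; rewrite kernel_expand /= !E6; do ?by rewrite ?(addSn, addnS) e.
move: e; case: i => [|[|[|[|i]]]]; case: j => [|[|[|[|j]]]];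
  case: k => [|[|[|[|k]]]] => // _;
  rewrite !(sphere_momentSS1, sphere_momentSS2, sphere_momentSS3)
    ?sphere_moment000 ?sphere_moment_odd// /monomial3 /dot; by field.
Qed.

(** Products of three linear forms span the cubic forms and cover every cubic to which reproduction
    is applied later. *)
Lemma kernel_reproducing y a b c :
  \sum_n w n * (cubic_kernel y (x n) * (dot a (x n) * dot b (x n) * dot c (x n))) =
  dot a y * dot b y * dot c y.
Proof.
pose M i j k := \sum_n w n * (cubic_kernel y (x n) * monomial3 i j k (x n)).
have expand v : dot a v * dot b v * dot c v =
  let a0 := tnth a ord0 in let a1 := tnth a 1 in let a2 := tnth a 2 in
  let b0 := tnth b ord0 in let b1 := tnth b 1 in let b2 := tnth b 2 in
  let c0 := tnth c ord0 in let c1 := tnth c 1 in let c2 := tnth c 2 in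
  a0 * b0 * c0 * monomial3 3 0 0 v + a1 * b1 * c1 * monomial3 0 3 0 v +
  a2 * b2 * c2 * monomial3 0 0 3 v +
  (a0 * b0 * c1 + a0 * b1 * c0 + a1 * b0 * c0) * monomial3 2 1 0 v +
  (a0 * b0 * c2 + a0 * b2 * c0 + a2 * b0 * c0) * monomial3 2 0 1 v +
  (a1 * b1 * c0 + a1 * b0 * c1 + a0 * b1 * c1) * monomial3 1 2 0 v +
  (a1 * b1 * c2 + a1 * b2 * c1 + a2 * b1 * c1) * monomial3 0 2 1 v +
  (a2 * b2 * c0 + a2 * b0 * c2 + a0 * b2 * c2) * monomial3 1 0 2 v +
  (a2 * b2 * c1 + a2 * b1 * c2 + a1 * b2 * c2) * monomial3 0 1 2 v +
  (a0 * b1 * c2 + a0 * b2 * c1 + a1 * b0 * c2 + a1 * b2 * c0 + a2 * b0 * c1 +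
   a2 * b1 * c0) * monomial3 1 1 1 v.
  by rewrite /dot /monomial3 /=; ring.
rewrite [RHS]expand /= -!kernel_monomial// !(mulr_sumr, =^~ big_split) /=.
by apply: eq_bigr => n _; rewrite expand /=; ring.
Qed.

Lemma cubature_norm n : dot (x n) (x n) = 1.
Proof. by have [_ + _ _] := cub => /(_ n) /S2_dot. Qed.

(** The value is the dimension of the space of cubic forms on 3-space. *)
Lemma kernel_node n : cubic_kernel (x n) (x n) = 10.
Proof. by rewrite /cubic_kernel cubature_norm; field. Qed.

Lemma kernel_idempotent y z :
  \sum_n w n * (cubic_kernel y (x n) * cubic_kernel (x n) z) = cubic_kernel y z.
Proof.
pose e0 : 3.-tuple R := vec3 1 0 0; pose e1 : 3.-tuple R := vec3 0 1 0.
pose e2 : 3.-tuple R := vec3 0 0 1.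
(* Writing [dot v v] as the sum of the squared coordinates makes the kernel a combination of
   products of three linear forms, to which reproduction applies. *)
have expand v : cubic_kernel v z =
    35 / 2 * (dot z v * dot z v * dot z v) + - (15 / 2) * dot z z *
    (dot z v * dot e0 v * dot e0 v + dot z v * dot e1 v * dot e1 v +
     dot z v * dot e2 v * dot e2 v).
  by rewrite /cubic_kernel /dot /e0 /e1 /e2 !(tnth_nth 0) /=; ring.
rewrite [RHS]expand -!kernel_reproducing !(mulr_sumr, =^~ big_split) /=.
by apply: eq_bigr => n _; rewrite expand; ring.
Qed.

(** The summand is an odd polynomial of degree 3 + 1 + 3 = 7, the full degree of the formula. *)
Lemma kernel_odd y z u :
  \sum_n w n * (cubic_kernel y (x n) * dot u (x n) * cubic_kernel (x n) z) = 0.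
Proof.
apply: (@cubature_odd (fun v => cubic_kernel y v * dot u v * cubic_kernel v z)) => [|v].
  apply: (polyfunM (polyfunM (polyfun_kernel y) (polyfun_dot u))).
  by under [X in polyfun _ X]eq_fun do rewrite cubic_kernelC; exact: polyfun_kernel.
by rewrite !(cubic_kernelC _ z) !cubic_kernelNr dotNr; ring.
Qed.

Lemma cubature_weight : \sum_n w n = 1.
Proof.
rewrite -(sphere_moment000 R) -cubature_moment//; apply: eq_bigr => n _.
by rewrite /monomial3; ring.
Qed.

Lemma cubature_dot2 u : \sum_n w n * dot u (x n) ^+ 2 = dot u u / 3.
Proof.
transitivity (tnth u ord0 ^+ 2 * E 2 0 0 + tnth u 1 ^+ 2 * E 0 2 0 +
  tnth u 2 ^+ 2 * E 0 0 2 + 2 * tnth u ord0 * tnth u 1 * E 1 1 0 +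
  2 * tnth u ord0 * tnth u 2 * E 1 0 1 + 2 * tnth u 1 * tnth u 2 * E 0 1 1).
  rewrite /E !(mulr_sumr, =^~ big_split) /=; apply: eq_bigr => n _.
  by rewrite /dot /monomial3; ring.
rewrite !E6// !(sphere_momentSS1, sphere_momentSS2, sphere_momentSS3)
  sphere_moment000 !sphere_moment_odd// /dot; by field.
Qed.

Lemma cubature_dot4 u : \sum_n w n * dot u (x n) ^+ 4 = dot u u ^+ 2 / 5.
Proof.
pose u0 := tnth u ord0; pose u1 := tnth u 1; pose u2 := tnth u 2.
transitivity (u0 ^+ 4 * E 4 0 0 + u1 ^+ 4 * E 0 4 0 + u2 ^+ 4 * E 0 0 4 +
  4 * u0 ^+ 3 * u1 * E 3 1 0 + 4 * u0 ^+ 3 * u2 * E 3 0 1 +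
  4 * u1 ^+ 3 * u0 * E 1 3 0 + 4 * u1 ^+ 3 * u2 * E 0 3 1 +
  4 * u2 ^+ 3 * u0 * E 1 0 3 + 4 * u2 ^+ 3 * u1 * E 0 1 3 +
  6 * u0 ^+ 2 * u1 ^+ 2 * E 2 2 0 + 6 * u0 ^+ 2 * u2 ^+ 2 * E 2 0 2 +
  6 * u1 ^+ 2 * u2 ^+ 2 * E 0 2 2 + 12 * u0 ^+ 2 * u1 * u2 * E 2 1 1 +
  12 * u0 * u1 ^+ 2 * u2 * E 1 2 1 + 12 * u0 * u1 * u2 ^+ 2 * E 1 1 2).
  rewrite /E !(mulr_sumr, =^~ big_split) /=; apply: eq_bigr => n _.
  by rewrite /dot /monomial3 -/u0 -/u1 -/u2; ring.
rewrite !E6// !(sphere_momentSS1, sphere_momentSS2, sphere_momentSS3)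
  sphere_moment000 !sphere_moment_odd// /dot -/u0 -/u1 -/u2; by field.
Qed.

End Cubature.
End Kernel.

(** * Linear algebra of the isotropic subspace *)

Section IsotropicSubspace.

(** In a full rank factorization [P = C B], idempotence cancels to [B C = 1], an identity of size
    [\rank P], and [C B] and [B C] have the same trace. *)
Lemma mxrank_idempotent (F : fieldType) n (P : 'M[F]_n) :
  P *m P = P -> \tr P = (\rank P)%:R.
Proof.
move=> PP; rewrite -{1}(mulmx_base P) mxtrace_mulC.
suff -> : row_base P *m col_base P = 1%:M by rewrite mxtrace1.
apply: (row_full_inj (col_base_full P)); apply: (row_free_inj (row_base_free P)).
have : (col_base P *m row_base P) *m (col_base P *m row_base P) =
       col_base P *m row_base P by rewrite mulmx_base.
by rewrite /= mulmx1 !mulmxA.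
Qed.

Variables (F : fieldType) (n r : nat).
Variables (P : 'M[F]_n) (w z a b : 'rV[F]_n).
Hypothesis le_n : (n <= (2 * r).+1)%N.
Hypothesis rankP : \rank P = r.
Hypothesis symP : P *m diag_mx w = diag_mx w *m P^T.
Hypothesis w0 : forall i, w 0 i != 0.
Hypothesis z0 : forall i, z 0 i != 0.
Hypothesis isoz : P *m diag_mx z *m P = 0.
Hypothesis isoa : P *m diag_mx a *m P = 0.
Hypothesis isob : P *m diag_mx b *m P = 0.

Let unit_diag (v : 'rV[F]_n) : (forall i, v 0 i != 0) -> diag_mx v \in unitmx.
Proof.
move=> v0; rewrite unitmxE det_diag unitfE.
by apply/prodf_neq0 => i _; exact: v0.
Qed.

(** The row spaces of [P], [Q] and [C] are the spaces [A], [zA] and [B] of the overview, and [omega]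
    is the Gram matrix of the form with weights [w / z]. The factor [z] cancels in the orthogonality
    to [zA], so [C] is written with [w] alone. *)
Let Q := P *m diag_mx z.
Let C := kermx (diag_mx w *m P^T).
Let omega := diag_mx (\row_i (w 0 i / z 0 i)).

Let rankQ : \rank Q = r.
Proof. by rewrite /Q mxrankMfree ?rankP// row_free_unit unit_diag. Qed.

Let rankC : (\rank C <= r.+1)%N.
Proof.
rewrite /C mxrank_ker -mxrank_tr trmx_mul trmxK tr_diag_mx mxrankMfree.
  by rewrite rankP leq_subLR addnS addnn -mul2n.
by rewrite row_free_unit unit_diag.
Qed.

Let subC (l : 'rV[F]_n) : P *m diag_mx l *m P = 0 -> (P *m diag_mx l <= C)%MS.
Proof. by move=> isol; apply/sub_kermxP; rewrite -symP mulmxA isol mul0mx. Qed.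

Let z_omega : diag_mx z *m omega = diag_mx w.
Proof.
rewrite /omega mulmx_diag; congr diag_mx; apply/rowP => i.
by rewrite !mxE mulrC divfK.
Qed.

Let omegaT : omega^T = omega. Proof. exact: tr_diag_mx. Qed.

Let omega_Q m (A : 'M[F]_(m, n)) : (A <= C)%MS -> A *m omega *m Q^T = 0.
Proof.
move=> /sub_kermxP AC; rewrite /Q trmx_mul tr_diag_mx.
by rewrite mulmxA -(mulmxA A) [omega *m _]diag_mxC z_omega -mulmxA.
Qed.

(** Multiplication by [a] and by [b] induces maps from [A] to [B / zA], at most a line. These maps
    are proportional, so some nontrivial combination is zero. *)
Lemma isotropic_pencil : exists2 c : (F * F)%type, c != (0, 0) &
  exists Y : 'M[F]_n, P *m diag_mx (c.1 *: a + c.2 *: b) = Y *m Q.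
Proof.
have [CQ|] := boolP (C <= Q)%MS.
  exists (1, 0); first by rewrite xpair_eqE oner_eq0.
  rewrite scale1r scale0r addr0.
  by have /submxP[Y ->] := submx_trans (subC isoa) CQ; exists Y.
case/row_subPn => i0; set e := row i0 C => eQ.
have eC : (e <= C)%MS := row_sub _ _.
have QC : (Q <= C)%MS := subC isoz.
have rankQe : (r < \rank (Q + e)%MS)%N.
  rewrite -rankQ; have : (Q < Q + e)%MS.
    by rewrite /ltmx addsmxSl addsmx_sub submx_refl.
  by rewrite ltmxErank => /andP[].
have CQe : (C <= Q + e)%MS.
  have QeC : (Q + e <= C)%MS by rewrite addsmx_sub QC.
  by rewrite -(geq_leqif (mxrank_leqif_sup QeC)) (leq_trans rankC).
pose eps := (e *m omega *m e^T) 0 0.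
have eps_e : e *m omega *m e^T = eps%:M by rewrite [LHS]mx11_scalar.
have Q_omega_e : Q *m omega *m e^T = 0.
  apply: trmx_inj; rewrite trmx0 trmx_mul trmxK (trmx_mul Q) omegaT mulmxA.
  exact: omega_Q.
(* Otherwise [Q + e] would be totally isotropic of rank at least [r + 1] for the nondegenerate form
   [omega], forcing [2 * (r + 1) <= n]. *)
have eps0 : eps != 0.
  apply/negP => /eqP eps0.
  have rankM : \rank (col_mx Q e) = \rank (Q + e)%MS by rewrite addsmxE.
  have : col_mx Q e *m (omega *m (col_mx Q e)^T) = 0.
    rewrite mulmxA mul_col_mx tr_col_mx mul_col_row.
    by rewrite (omega_Q QC) (omega_Q eC) Q_omega_e eps_e eps0 raddf0 block_mx0.
  move/mulmx0_rank_max; rewrite -(mxrank_tr (omega *m _)) trmx_mul trmxK omegaT mxrankMfree.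
    rewrite !rankM => H; have := leq_trans (leq_add rankQe rankQe) (leq_trans H le_n).
    by rewrite addSn addnS addnn -mul2n ltnn.
  rewrite row_free_unit; apply: unit_diag => i.
  by rewrite mxE mulf_neq0 ?invr_eq0.
have /sub_addsmxP[ua Ea] := submx_trans (subC isoa) CQe.
have /sub_addsmxP[ub Eb] := submx_trans (subC isob) CQe.
have gram l (A : 'M[F]_n) (u : ('M[F]_n * 'cV[F]_n)%type) : (A <= C)%MS ->
    P *m diag_mx l = u.1 *m Q + u.2 *m e ->
    A *m omega *m (P *m diag_mx l)^T = A *m omega *m e^T *m u.2^T.
  move=> AC ->; rewrite linearD /= (trmx_mul u.1) (trmx_mul u.2) mulmxDr !mulmxA.
  by rewrite (omega_Q AC) mul0mx add0r.
have gram_e l (u : ('M[F]_n * 'cV[F]_n)%type) : P *m diag_mx l = u.1 *m Q + u.2 *m e ->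
    P *m diag_mx l *m omega *m e^T = eps *: u.2.
  move=> ->; rewrite !mulmxDl -2!(mulmxA u.1) Q_omega_e mulmx0 add0r.
  by rewrite -2!(mulmxA u.2) eps_e mul_mx_scalar.
(* Up to the factor [eps], both sides are the Gram matrix of [aA] against [bA], which is unchanged
   when [a] and [b] are exchanged. *)
have : ua.2 *m ub.2^T = ub.2 *m ua.2^T.
  apply: (scalerI eps0); rewrite !scalemxAl -(gram_e _ _ Ea) -(gram_e _ _ Eb).
  rewrite -(gram _ _ _ (subC isoa) Eb) -(gram _ _ _ (subC isob) Ea).
  have swap : diag_mx a *m omega *m diag_mx b = diag_mx b *m omega *m diag_mx a.
    rewrite /omega !mulmx_diag; congr diag_mx; apply/rowP => i.
    by rewrite !mxE; ring.
  have := congr1 (fun A => P *m A *m P^T) swap.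
  by rewrite !(trmx_mul P) !tr_diag_mx !mulmxA.
move=> /matrixP uab.
have prop i k : ua.2 i 0 * ub.2 k 0 = ub.2 i 0 * ua.2 k 0.
  by have := uab i k; rewrite !mxE !big_ord1 !mxE.
have comb c d : c *: ua.2 + d *: ub.2 = 0 ->
    P *m diag_mx (c *: a + d *: b) = (c *: ua.1 + d *: ub.1) *m Q.
  move=> u0; rewrite linearD /= !linearZ /= mulmxDr -!scalemxAr Ea Eb.
  rewrite mulmxDl -!scalemxAl !scalerDr addrACA.
  by rewrite [X in _ + X = _](_ : _ = 0) ?addr0// !scalemxAl -mulmxDl u0 mul0mx.
have [ua0|/eqP/matrix0Pn[k [l uak]]] := ua.2 =P 0.
  exists (1, 0); first by rewrite xpair_eqE oner_eq0.
  by exists (1 *: ua.1 + 0 *: ub.1); rewrite comb// ua0 scaler0 scale0r addr0.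
rewrite ord1 in uak.
(* These coefficients cancel the components along [e], the columns [ua.2] and [ub.2] being
   proportional. *)
exists (ub.2 k 0, - ua.2 k 0).
  by rewrite xpair_eqE oppr_eq0 (negbTE uak) andbF.
exists (ub.2 k 0 *: ua.1 - ua.2 k 0 *: ub.1); rewrite comb ?scaleNr//.
apply/matrixP => i j; rewrite ord1 !mxE mulrC prop; ring.
Qed.

End IsotropicSubspace.

(** * Vector identities in 3-space *)

Section Vectors.
Variable R : realType.
Implicit Types (u v y z n p q : 3.-tuple R).

Definition cross u v : 3.-tuple R :=
  vec3 (tnth u 1 * tnth v 2 - tnth u 2 * tnth v 1)
       (tnth u 2 * tnth v ord0 - tnth u ord0 * tnth v 2)
       (tnth u ord0 * tnth v 1 - tnth u 1 * tnth v ord0).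

Definition scale3 (c : R) v : 3.-tuple R :=
  vec3 (c * tnth v ord0) (c * tnth v 1) (c * tnth v 2).

Local Ltac vring := rewrite /dot /cross /scale3 !(tnth_nth 0) /=; ring.

Lemma dot_scale3 u c v : dot u (scale3 c v) = c * dot u v.
Proof. by vring. Qed.

Lemma cubic_kernel_scale3 u c v : cubic_kernel u (scale3 c v) = c ^+ 3 * cubic_kernel u v.
Proof. by rewrite /cubic_kernel; vring. Qed.

Lemma eq_tuple3 u v : tnth u ord0 = tnth v ord0 -> tnth u 1 = tnth v 1 ->
  tnth u 2 = tnth v 2 -> u = v.
Proof.
move=> e0 e1 e2; apply: eq_from_tnth => -[[|[|[|//]]] l].
- by rewrite (_ : Ordinal l = ord0)//; apply: val_inj.
- by rewrite (_ : Ordinal l = 1)//; apply: val_inj.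
- by rewrite (_ : Ordinal l = 2)//; apply: val_inj.
Qed.

Lemma dot_eq0 v : dot v v = 0 -> forall u, dot v u = 0.
Proof.
rewrite /dot -!expr2 => /eqP; rewrite !paddr_eq0 ?addr_ge0 ?sqr_ge0//.
by rewrite !sqrf_eq0 => /and3P[/eqP-> /eqP-> /eqP->] u; ring.
Qed.

Lemma dot_cross u v : dot (cross u v) (cross u v) = dot u u * dot v v - dot u v ^+ 2.
Proof. by vring. Qed.

Lemma cross_cross_dot u v y z :
  dot (cross u v) (cross y z) = dot u y * dot v z - dot u z * dot v y.
Proof. by vring. Qed.

Lemma unit_parallel u v : dot u u = 1 -> dot v v = 1 ->
  dot (cross u v) (cross u v) = 0 ->
  exists2 c : R, c ^+ 2 = 1 & v = scale3 c u.
Proof.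
move=> u1 v1 uv0; have uvc := dot_eq0 uv0; exists (dot u v).
  by move: uv0; rewrite dot_cross u1 v1 mul1r => /eqP; rewrite subr_eq0 => /eqP.
have vE y : dot v y = dot u v * dot u y.
  have := uvc (cross u y); rewrite cross_cross_dot u1 mul1r (dotC v u) => /eqP.
  by rewrite subr_eq0 => /eqP ->; rewrite mulrC.
have vE' y : dot v y = dot (scale3 (dot u v) u) y.
  by rewrite vE (dotC (scale3 _ _)) dot_scale3 (dotC y).
apply: eq_tuple3.
- by have := vE' (vec3 1 0 0); rewrite /dot !(tnth_nth 0) /= !(mulr0, mulr1, addr0, add0r).
- by have := vE' (vec3 0 1 0); rewrite /dot !(tnth_nth 0) /= !(mulr0, mulr1, addr0, add0r).
- by have := vE' (vec3 0 0 1); rewrite /dot !(tnth_nth 0) /= !(mulr0, mulr1, addr0, add0r).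
Qed.

(* [p] is orthogonal to [n], [n'], hence proportional to their cross product,
   which is not orthogonal to [z] whereas [p] is. *)
Lemma orthogonal3_eq0 p z n n' : dot p z = 0 -> dot p n = 0 -> dot p n' = 0 ->
  dot z (cross n n') != 0 -> dot p p = 0.
Proof.
move=> pz pn pn' zm; apply: (mulfI zm); rewrite mulr0.
transitivity (dot p z * dot (cross n n') p + dot p n' * dot p (cross z n) -
              dot p n * dot p (cross z n')); first by vring.
by rewrite pz pn pn' !mul0r addr0 subr0.
Qed.

(** Pythagoras in the plane orthogonal to [n], for the orthogonal pair formed by [cross n q] and the
    projection of [q]. *)
Lemma dot_axis n q v : dot n v = 0 ->
  dot (cross n q) v ^+ 2 + dot q v ^+ 2 * dot n n =
  dot (cross n q) (cross n q) * dot v v - dot q q * dot n v ^+ 2.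
Proof.
move=> nv; transitivity (dot n n * dot q q * dot v v
  + 2 * dot n q * dot q v * dot n v - dot q q * dot n v ^+ 2
  - dot v v * dot n q ^+ 2); first by vring.
by rewrite nv dot_cross; ring.
Qed.

(** If [cross n q] is nonzero, two vectors of the plane orthogonal to [n] are parallel as soon as
    their coordinate pairs against [q] and [cross n q] are proportional. *)
Lemma planar_det n q v y : dot n n != 0 -> dot n v = 0 -> dot n y = 0 ->
  (dot q v * dot (cross n q) y - dot (cross n q) v * dot q y) ^+ 2 * dot n n =
  dot (cross v y) (cross v y) * dot (cross n q) (cross n q) ^+ 2.
Proof.
move=> n0 nv ny; apply: (mulfI n0); set D := _ - _.
have D_n : D * dot n n = dot n (cross v y) * dot (cross n q) (cross n q).
  pose X := dot n y * (dot q q * dot n (cross v n) - dot n q * dot q (cross v n))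
    - dot n v * (dot q q * dot n (cross y n) - dot n q * dot q (cross y n)).
  transitivity (dot n (cross v y) * dot (cross n q) (cross n q) + X);
    first by rewrite /D /X; vring.
  by rewrite /X nv ny !mul0r subr0 addr0.
have vy_n : dot n n * dot (cross v y) (cross v y) = dot n (cross v y) ^+ 2.
  transitivity (dot n (cross v y) ^+ 2 + (dot v v * dot n y ^+ 2
    - 2 * dot v y * dot n y * dot n v + dot y y * dot n v ^+ 2)); first by vring.
  by rewrite nv ny; ring.
transitivity ((D * dot n n) ^+ 2); first by ring.
by rewrite D_n exprMn -vy_n; ring.
Qed.

(** On the curve [(1, t, t ^ 2)] each condition excludes only the roots of a nonzero polynomial in
    [t]. The normalization [tnth z ord0 = 1] later keeps [z] independent of every nonzero
    [vec3 0 c.1 c.2]. *)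
Lemma exists_nonorthogonal (s : seq (3.-tuple R)) :
  (forall v, v \in s -> dot v v != 0) ->
  exists2 z, tnth z ord0 = 1 & forall v, v \in s -> dot z v != 0.
Proof.
move=> s0; pose f v : {poly R} :=
  (tnth v ord0)%:P + tnth v 1 *: 'X + tnth v 2 *: 'X^2.
have fE v t : (f v).[t] = dot (vec3 1 t (t ^+ 2)) v.
  by rewrite /f !hornerE /dot !(tnth_nth 0) /=; ring.
have f0 v : v \in s -> f v != 0.
  move=> vs; apply: contra (s0 _ vs) => /eqP fv0.
  have c0 l : (f v)`_l = 0 by rewrite fv0 coef0.
  have := c0 0%N; have := c0 1%N; have := c0 2%N.
  rewrite /f !coefD !coefC !coefZ !coefX !coefXn /= !(mulr0, mulr1, addr0, add0r).
  by move=> v2 v1 v0; rewrite /dot v0 v1 v2 !mulr0 !addr0.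
pose g := \prod_(v <- s) f v.
have g0 : g != 0 by rewrite /g prodf_seq_neq0; apply/allP => v /f0.
have [t gt] : exists t : R, g.[t] != 0.
  apply/not_existsP => h.
  pose rs : seq R := [seq k%:R | k <- iota 0 (size g)].
  have urs : uniq rs.
    by rewrite map_inj_uniq ?iota_uniq// => i j /eqP; rewrite eqr_nat => /eqP.
  have ars : all (root g) rs.
    by apply/allP => r _; apply/rootP/eqP; case: eqP => // /eqP /(h r).
  by have := max_poly_roots g0 ars urs; rewrite size_map size_iota ltnn.
exists (vec3 1 t (t ^+ 2)) => // v vs; rewrite -fE; apply: contra gt => /eqP fv.
by rewrite /g (big_rem v)//= hornerM fv mul0r.
Qed.

End Vectors.

(** * No formula of degree seven has at most 21 nodes *)

Section LowerBound.
Variables (R : realType) (N : nat) (x : 'I_N -> 3.-tuple R) (w : 'I_N -> R).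
Hypothesis cub : positive_cubature 7 x w.
Hypothesis le_N : (N <= 21)%N.
Implicit Types (u v y z p q : 3.-tuple R).

Let K i j := cubic_kernel (x i) (x j).

Let x1 i : dot (x i) (x i) = 1. Proof. exact: cubature_norm cub i. Qed.

Let w_gt0 i : 0 < w i. Proof. by have [_ _ + _] := cub. Qed.

Let KC i j : K i j = K j i. Proof. exact: cubic_kernelC. Qed.

Let K_idem i k : \sum_j w j * (K i j * K j k) = K i k.
Proof. exact: kernel_idempotent cub (x i) (x k). Qed.

Let P := \matrix_(i, j) (w i * K i j).
Let W := \row_i w i.
Let values u := \row_i dot u (x i).

Let idP : P *m P = P.
Proof.
apply/matrixP => i k; rewrite !mxE -[in RHS]K_idem mulr_sumr.
by apply: eq_bigr => j _; rewrite !mxE; ring.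
Qed.

Let rankP : \rank P = 10%N.
Proof.
apply/eqP; rewrite -(eqr_nat R) -mxrank_idempotent//; apply/eqP.
transitivity (\sum_i w i * 10); last first.
  by rewrite -mulr_suml (cubature_weight cub) mul1r.
by apply: eq_bigr => i _; rewrite !mxE /K (kernel_node cub).
Qed.

Let symP : P *m diag_mx W = diag_mx W *m P^T.
Proof.
by rewrite mul_mx_diag mul_diag_mx; apply/matrixP => i j; rewrite !mxE KC; ring.
Qed.

Let isotropic u : P *m diag_mx (values u) *m P = 0.
Proof.
apply/matrixP => i k; rewrite mul_mx_diag !mxE.
transitivity (w i * \sum_j w j * (K i j * dot u (x j) * K j k)).
  by rewrite mulr_sumr; apply: eq_bigr => j _; rewrite !mxE; ring.
by rewrite (kernel_odd cub) mulr0.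
Qed.

Lemma kernel_pencil z : (forall i, dot z (x i) != 0) ->
  exists2 c : (R * R)%type, c != (0, 0) &
  forall i j, let l := vec3 0 c.1 c.2 in
    (dot l (x i) * dot z (x j) - dot l (x j) * dot z (x i)) * K i j = 0.
Proof.
move=> z0; pose e1 : 3.-tuple R := vec3 0 1 0; pose e2 : 3.-tuple R := vec3 0 0 1.
have [||c c0 [Y EY]] := @isotropic_pencil _ _ 10 _ _ _ _ _ le_N rankP symP
  _ _ (isotropic z) (isotropic e1) (isotropic e2).
- by move=> i; rewrite mxE gt_eqF.
- by move=> i; rewrite mxE.
exists c => // i k; set l := vec3 0 c.1 c.2; rewrite /=.
pose r j := dot l (x j) / dot z (x j).
have Er : P *m diag_mx (\row_j r j) = Y *m P.
  have lE : c.1 *: values e1 + c.2 *: values e2 = values l.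
    by apply/rowP => j; rewrite !mxE /dot !(tnth_nth 0) /=; ring.
  rewrite lE in EY.
  apply: (@row_free_inj _ _ _ _ (diag_mx (values z))).
    rewrite row_free_unit unitmxE det_diag unitfE.
    by apply/prodf_neq0 => j _; rewrite mxE.
  rewrite /= -!mulmxA mulmx_diag -EY; congr (_ *m diag_mx _); apply/rowP => j.
  by rewrite !mxE /r divfK.
have PrP : P *m diag_mx (\row_j r j) *m P = P *m diag_mx (\row_j r j).
  by rewrite Er -mulmxA idP.
(* The left side is symmetric in [a] and [b], so comparing with the exchanged identity gives
   [(r a - r b) * K a b = 0]. *)
have S a b : \sum_j w j * (K a j * r j * K j b) = K a b * r b.
  have := congr1 (fun A : 'M[R]_N => A a b) PrP; rewrite mul_mx_diag !mxE => E.
  apply: (mulfI (lt0r_neq0 (w_gt0 a))); rewrite [RHS]mulrA -[RHS]E mulr_sumr.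
  by apply: eq_bigr => j _; rewrite !mxE; ring.
have := S i k; have := S k i.
rewrite (eq_bigr (fun j => w j * (K i j * r j * K j k))); last first.
  by move=> j _; rewrite (KC k j) (KC j i); ring.
move=> -> E; have {E} : (r i - r k) * K i k = 0.
  by rewrite mulrBl mulrC (KC i k) E (KC i k) mulrC subrr.
move=> E; transitivity ((dot z (x i) * dot z (x k)) * ((r i - r k) * K i k)).
  by rewrite /r; field; rewrite !z0.
by rewrite E mulr0.
Qed.

(** If the planes differed, choose [z] not orthogonal to their common line. The axis [cross z l]
    from [kernel_pencil] lies in both planes, hence on that line, yet is orthogonal to [z]; so it is
    zero, contradicting the independence of [z] and [l]. *)
Lemma kernel_planes i j i' j' : K i j != 0 -> K i' j' != 0 ->
  dot (cross (cross (x i) (x j)) (cross (x i') (x j')))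
      (cross (cross (x i) (x j)) (cross (x i') (x j'))) = 0.
Proof.
move=> Kij Kij'; set n := cross (x i) (x j); set n' := cross (x i') (x j').
apply/eqP/negP => /negP m0.
have [|z z1 zP] := @exists_nonorthogonal _ (cross n n' :: codom x).
  move=> v; rewrite inE => /predU1P[->//|/codomP[l ->]].
  by rewrite x1 oner_eq0.
have zx l : dot z (x l) != 0 by rewrite zP// inE codom_f orbT.
have zm : dot z (cross n n') != 0 by rewrite zP// inE eqxx.
have [c c0 cP] := kernel_pencil zx.
set l := vec3 0 c.1 c.2 in cP; pose p := cross z l.
have p_pair a b : K a b != 0 -> dot p (cross (x a) (x b)) = 0.
  move=> Kab; have /eqP := cP a b; rewrite /= mulf_eq0 (negbTE Kab) orbF.
  by move=> /eqP E; rewrite /p cross_cross_dot -[RHS]oppr0 -[in RHS]E; ring.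
have pz : dot p z = 0 by rewrite /p /dot /cross !(tnth_nth 0) /=; ring.
have /dot_eq0 p0 := orthogonal3_eq0 pz (p_pair _ _ Kij) (p_pair _ _ Kij') zm.
have := p0 (vec3 0 1 0); have := p0 (vec3 0 0 1).
rewrite /p /dot /cross z1 !(tnth_nth 0) /=.
rewrite !(mulr0, mul0r, mulr1, mul1r, addr0, add0r, subr0, sub0r) => c1 /eqP.
by rewrite oppr_eq0 => /eqP c2; move: c0; rewrite [c]surjective_pairing c1 c2 eqxx.
Qed.

Let par i j := dot (cross (x i) (x j)) (cross (x i) (x j)) == 0.

Let good i := forall j, ~~ par i j -> K i j = 0.

(** If every node were orthogonal or parallel to [n], the fourth moment along [n] would be [dot n n]
    times the second, that is 1/5 = 1/3 after scaling. *)
Let exists_oblique n : dot n n != 0 ->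
  exists i, dot n (x i) != 0 /\ dot (cross n (x i)) (cross n (x i)) != 0.
Proof.
move=> n0; apply/not_existsP => h.
have e4 i : dot n (x i) ^+ 4 = dot n n * dot n (x i) ^+ 2.
  have [->|ni] := eqVneq (dot n (x i)) 0; first by ring.
  have [/eqP|cni] := eqVneq (dot (cross n (x i)) (cross n (x i))) 0; last by case: (h i).
  rewrite dot_cross x1 mulr1 subr_eq0 => /eqP ->; ring.
have : \sum_i w i * dot n (x i) ^+ 4 = dot n n * \sum_i w i * dot n (x i) ^+ 2.
  by rewrite mulr_sumr; apply: eq_bigr => i _; rewrite e4 mulrCA.
rewrite (cubature_dot4 cub) (cubature_dot2 cub) => E.
have : dot n n ^+ 2 = 0 by lra.
by move/eqP; rewrite sqrf_eq0 (negbTE n0).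
Qed.

(** A non-parallel partner [j] with [K i j != 0] would span with [i] the plane of [i0] and [j0],
    which does not contain [x i]. *)
Let good_off_plane i0 j0 i : K i0 j0 != 0 ->
  dot (cross (x i0) (x j0)) (x i) != 0 -> good i.
Proof.
move=> K0 ni j nij; apply/eqP/negP => /negP Kij; move/negP: ni; apply; apply/eqP.
set n := cross _ _; pose c := cross (x i) (x j).
have cx : dot c (x i) = 0 by rewrite /c /dot /cross !(tnth_nth 0) /=; ring.
apply: (mulfI nij); rewrite mulr0.
transitivity (dot (cross n c) (cross (x i) c) + dot n c * dot c (x i)).
  by rewrite -/c cross_cross_dot; ring.
by rewrite (dot_eq0 (kernel_planes K0 Kij)) cx mulr0 addr0.
Qed.

Let par_scale i j : par i j -> exists2 c : R, c ^+ 2 = 1 & x j = scale3 c (x i).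
Proof. by move=> /eqP /(unit_parallel (x1 i) (x1 j)). Qed.

(** * From the nodes off a plane to those inside it *)

Section Plane.
Variables (n : 3.-tuple R) (e : 'I_N).
Hypothesis n0 : dot n n != 0.
Hypothesis off_plane : forall i, dot n (x i) != 0 -> good i.
Hypothesis e_off : dot n (x e) != 0.
Hypothesis e_oblique : dot (cross n (x e)) (cross n (x e)) != 0.

Let t i := dot (x e) (x i).
Let s i := dot (cross n (x e)) (x i).
Let M := dot (cross n (x e)) (cross n (x e)).

Let plane_t i : dot n (x i) = 0 -> t i = 0 \/ t i ^+ 2 = 3 / 7.
Proof.
move=> ni; have : K e i = 0.
  apply: off_plane => //; apply: contra e_off => /eqP ei.
  have := dot_eq0 ei (cross n (x i)).
  by rewrite cross_cross_dot x1 mulr1 (dotC (x i)) ni mulr0 subr0 dotC => ->.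
rewrite /K /cubic_kernel !x1 -/(t i) => /eqP; rewrite mulf_eq0 => /orP[/eqP->|/eqP h].
  by left.
by right; lra.
Qed.

Let plane_st i : dot n (x i) = 0 -> s i ^+ 2 + t i ^+ 2 * dot n n = M.
Proof. by move=> ni; rewrite dot_axis// x1 ni; rewrite /M; ring. Qed.

(* By [plane_t] and [plane_st] the pair [(t i, s i)] takes at most three values up
   to sign, that is, the nodes of the plane lie on at most three lines. *)
Let separating_cubic k : dot n (x k) = 0 ->
  exists2 g : 3.-tuple R -> R,
    [/\ g (x k) != 0,
        forall i, dot n (x i) = 0 -> ~~ par i k -> g (x i) = 0 &
        forall c v, g (scale3 c v) = c ^+ 3 * g v] &
    forall v, \sum_i w i * (cubic_kernel v (x i) * g (x i)) = g v.
Proof.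
move=> nk; pose T v := dot (x e) v; pose S v := dot (cross n (x e)) v.
have det_neq0 i : dot n (x i) = 0 -> ~~ par i k -> t i * s k - s i * t k != 0.
  move=> ni /negP ik; apply/eqP => D0; apply: ik.
  have := planar_det (x e) n0 ni nk; rewrite -/(t i) -/(s k) -/(s i) -/(t k) D0.
  rewrite expr0n mul0r => /esym/eqP; rewrite mulf_eq0 expf_eq0 /= (negbTE e_oblique).
  by rewrite orbF.
have [tk|tk] := eqVneq (t k) 0.
  (* [r] is the common value of [s ^ 2 / t ^ 2] on the lines with nonzero [t], so the cubic below
     vanishes there. *)
  pose r := 7 / 3 * (M - 3 / 7 * dot n n).
  exists (fun v => S v * S v * S v - r * (T v * T v * S v)); last first.
    move=> v; rewrite -!(kernel_reproducing cub v) mulr_sumr -sumrB.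
    by apply: eq_bigr => i _; rewrite /S /T; ring.
  have := plane_st nk; rewrite tk expr0n mul0r addr0 => sk.
  split=> [|i ni ik|c v]; last by rewrite /S /T !dot_scale3; ring.
    rewrite /S /T -/(t k) -/(s k) tk !mul0r mulr0 subr0 -expr2 sk mulf_neq0//.
    by rewrite -sqrf_eq0 sk.
  have := det_neq0 i ni ik; rewrite tk mulr0 subr0 mulf_eq0 negb_or => /andP[ti _].
  have t2 : t i ^+ 2 = 3 / 7 by case: (plane_t ni) => // ti0; rewrite ti0 eqxx in ti.
  have s2 : s i ^+ 2 = M - 3 / 7 * dot n n.
    by rewrite -(plane_st ni) t2 addrK.
  transitivity (s i * (s i ^+ 2 - r * t i ^+ 2)).
    by rewrite /S /T -/(t i) -/(s i); ring.
  by rewrite s2 t2 /r; field.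
have t2 : t k ^+ 2 = 3 / 7 by case: (plane_t nk) => // tk0; rewrite tk0 eqxx in tk.
have s2 i : dot n (x i) = 0 -> t i != 0 -> t i ^+ 2 = 3 / 7 /\ s i ^+ 2 = s k ^+ 2.
  move=> ni ti; have t2i : t i ^+ 2 = 3 / 7.
    by case: (plane_t ni) => // ti0; rewrite ti0 eqxx in ti.
  by have := plane_st ni; rewrite -(plane_st nk) t2 t2i => /addIr.
have [sk|sk] := eqVneq (s k) 0.
  exists (fun v => T v * T v * T v); last by move=> v; rewrite (kernel_reproducing cub).
  split=> [|i ni ik|c v]; last by rewrite /T !dot_scale3; ring.
    by rewrite !mulf_neq0.
  have := det_neq0 i ni ik; rewrite sk mulr0 sub0r oppr_eq0 mulf_eq0 negb_or.
  move=> /andP[si _]; rewrite /T -/(t i).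
  have [->|ti] := eqVneq (t i) 0; first by rewrite mulr0.
  have [_] := s2 i ni ti; rewrite sk expr0n => /eqP.
  by rewrite sqrf_eq0 (negbTE si).
(* The factor [T ^ 2] kills the line [t = 0], and [s k * T + t k * S] kills the mirror line through
   [(t k, - s k)]. *)
exists (fun v => s k * (T v * T v * T v) + t k * (T v * T v * S v)); last first.
  move=> v; rewrite -!(kernel_reproducing cub v) !mulr_sumr -big_split.
  by apply: eq_bigr => i _; rewrite /S /T /=; ring.
split=> [|i ni ik|c v]; last by rewrite /S /T !dot_scale3; ring.
  rewrite /S /T -/(t k) -/(s k) (_ : _ + _ = 2 * (s k * t k ^+ 3)); last by ring.
  by rewrite !mulf_neq0 ?expf_neq0 ?pnatr_eq0.
rewrite /S /T -/(t i) -/(s i).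
have [->|ti] := eqVneq (t i) 0; first by rewrite !(mul0r, mulr0) addr0.
have [t2i s2i] := s2 i ni ti.
apply: (mulfI (det_neq0 i ni ik)).
transitivity (t i ^+ 2 * (t i ^+ 2 * s k ^+ 2 - s i ^+ 2 * t k ^+ 2)); first by ring.
by rewrite s2i t2 t2i; ring.
Qed.

(** Reproducing the separating cubic at another line of the plane, only nodes parallel to [x k]
    contribute, all with the same sign since kernel and cubic are both odd; thus a positive multiple
    of [K j k * g (x k)] is 0. *)
Let good_plane k : dot n (x k) = 0 -> good k.
Proof.
move=> nk j; have [nj|nj] := eqVneq (dot n (x j)) 0; last first.
  move=> jk; rewrite KC; apply: off_plane => //.
  by apply: contra jk; rewrite /par !dot_cross (dotC (x k)) mulrC.
have [g [gk g0 gZ] gE] := separating_cubic nk.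
move=> kj; have jk : ~~ par j k.
  by apply: contra kj; rewrite /par !dot_cross (dotC (x k)) mulrC.
have term i : w i * (cubic_kernel (x j) (x i) * g (x i)) =
    (if par k i then w i else 0) * (K j k * g (x k)).
  case: ifPn => [/par_scale[c c2 ->]|ki].
    rewrite cubic_kernel_scale3 gZ -/(K j k).
    transitivity (w i * ((c ^+ 2) ^+ 3 * (K j k * g (x k)))); first by ring.
    by rewrite c2 expr1n mul1r.
  rewrite mul0r; have [ni|ni] := eqVneq (dot n (x i)) 0.
    rewrite g0 ?mulr0//; apply: contra ki.
    by rewrite /par !dot_cross (dotC (x k)) mulrC.
  rewrite -/(K j i) KC (off_plane ni) ?mul0r ?mulr0//.
  apply: contra ni => /par_scale[c c2 xj]; move: nj; rewrite xj dot_scale3.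
  move/eqP; rewrite mulf_eq0 => /orP[/eqP c0|//].
  by move: c2; rewrite c0 expr0n => /esym/eqP; rewrite oner_eq0.
have := gE (x j); rewrite (g0 j nj jk) (eq_bigr _ (fun i _ => term i)) -mulr_suml.
move/eqP; rewrite mulf_eq0 mulf_eq0 (negbTE gk) orbF => /orP[/eqP W0|/eqP].
  have : 0 < \sum_i (if par k i then w i else 0).
    rewrite (bigD1 k)//= ifT; last by rewrite /par dot_cross; apply/eqP; ring.
    by rewrite ltr_pwDl// sumr_ge0// => i _; case: ifP => // _; exact/ltW.
  by rewrite W0 ltxx.
by rewrite KC.
Qed.

Lemma all_good_of_plane i : good i.
Proof.
by have [/good_plane|/off_plane] := eqVneq (dot n (x i)) 0.
Qed.

End Plane.

Let all_good i : good i.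
Proof.
apply/not_notP => /existsNP[j /not_implyP[ij /eqP Kij]].
pose n := cross (x i) (x j).
have off k : dot n (x k) != 0 -> good k by exact: good_off_plane.
have [e [ne ce]] := exists_oblique ij.
by move/eqP: Kij; apply; exact: (all_good_of_plane ij off ne ce).
Qed.

Let antipodal i j : par i j -> j != i -> dot (x i) (x j) = -1.
Proof.
move=> /par_scale[c /eqP]; rewrite sqrf_eq1 => /orP[/eqP->|/eqP->] xj ij.
  have [inj _ _ _] := cub; case/eqP: ij; apply: inj; rewrite xj.
  by apply: eq_tuple3; rewrite /scale3 (tnth_nth 0) /= mul1r.
by rewrite xj dot_scale3 x1 mulr1.
Qed.

(** [V] is the weight of the antipode, 0 if it is not a node. Idempotence of the kernel gives
    [w i + V = 1 / 10] and oddness gives [w i = V]. *)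
Let weight_eq i : w i = 1 / 20.
Proof.
pose V := \sum_(j | par i j && (j != i)) w j.
have ii : par i i by rewrite /par dot_cross; apply/eqP; ring.
have K2 j : par i j -> K i j ^+ 2 = 100.
  move=> /par_scale[c c2 xj]; rewrite /K xj cubic_kernel_scale3 (kernel_node cub).
  transitivity ((c ^+ 2) ^+ 3 * 100); first by ring.
  by rewrite c2; ring.
have sumE (F : 'I_N -> R) : \sum_j w j * K i j ^+ 2 * F j =
    100 * (w i * F i + \sum_(j | par i j && (j != i)) w j * F j).
  rewrite (bigID (par i)) /= [X in _ + X]big1 ?addr0; last first.
    by move=> j /all_good ->; ring.
  rewrite (bigD1 i)//= mulrDr mulr_sumr K2//; congr (_ + _); first by ring.
  by apply: eq_bigr => j /andP[/K2 -> _]; ring.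
have E1 : 100 * (w i + V) = 10.
  transitivity (\sum_j w j * K i j ^+ 2 * 1).
    by rewrite sumE; under eq_bigr do rewrite mulr1; rewrite mulr1.
  rewrite -(kernel_node cub i) -/(K i i) -[RHS]K_idem; apply: eq_bigr => j _.
  by rewrite (KC j); ring.
have E2 : 100 * (w i - V) = 0.
  transitivity (\sum_j w j * K i j ^+ 2 * dot (x i) (x j)).
    rewrite sumE x1 mulr1; congr (_ * (_ + _)); rewrite -sumrN.
    by apply: eq_bigr => j /andP[ij ji]; rewrite antipodal// mulrN1.
  rewrite -[RHS](kernel_odd cub (x i) (x i) (x i)); apply: eq_bigr => j _.
  by rewrite -/(K i j) -/(K j i) (KC j); ring.
by lra.
Qed.

Lemma no_small_cubature : False.
Proof.
have N0 : (0 < N)%N.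
  case: (posnP N) => // N0; have := cubature_weight cub; rewrite big1.
    by move/esym/eqP; rewrite oner_eq0.
  by move=> i; have := ltn_ord i; rewrite [X in (_ < X)%N]N0.
pose i := Ordinal N0.
pose a := (\sum_j par i j)%N.
pose b := (\sum_j (~~ par i j && (dot (x i) (x j) != 0%R)))%N.
have term j : dot (x i) (x j) ^+ 2 =
    (par i j)%:R + 3 / 7 * (~~ par i j && (dot (x i) (x j) != 0))%:R.
  have [ij|/all_good Kij] := boolP (par i j).
    move: ij; rewrite /par dot_cross !x1 mulr1 subr_eq0 => /eqP <-.
    by rewrite mulr0 addr0.
  have [->|t0] := eqVneq (dot (x i) (x j)) 0; first by rewrite mulr0 expr0n addr0.
  move/eqP: Kij; rewrite /K /cubic_kernel !x1 mulf_eq0 (negbTE t0) /= => /eqP h.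
  by lra.
have : \sum_j w j * dot (x i) (x j) ^+ 2 = 1 / 3.
  by rewrite (cubature_dot2 cub) x1.
under eq_bigr do rewrite weight_eq term.
rewrite -mulr_sumr big_split /= -mulr_sumr -!natr_sum -/a -/b => E.
(* The second moment along [x i] cleared of denominators; 3 divides the left side but not 140. *)
have /eqP : (21 * a + 9 * b)%:R = 140%:R :> R by rewrite natrD !natrM; lra.
by rewrite eqr_nat => /eqP; lia.
Qed.

End LowerBound.

Theorem proposition4p3 (R : realType) :
  positive_cubature 7 (@node R) (@weight R) /\ min_nodes R 7 = 22%N.
Proof.
split; first exact: node_cubature.
have has22 : has_cubature R 7 22.
  have card22 : #|{: 'I_11 * bool}| = 22%N by rewrite card_prod card_ord card_bool.
  rewrite -card22.
  exists (@node R \o enum_val), (@weight R \o enum_val).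
  have [inj on_S2 pos cub] := node_cubature R; split.
  - exact: inj_comp inj enum_val_inj.
  - by move=> i; exact: on_S2.
  - by move=> i; exact: pos.
  - move=> f /cub ->; congr EFin.
    by rewrite (reindex _ (onW_bij _ (@enum_val_bij _))).
have min22 m : has_cubature R 7 m -> (22 <= m)%N.
  by move=> [x [w cub]]; rewrite leqNgt; apply/negP => /(no_small_cubature cub).
(* [has22] and [min22] make 22 a least node count, which excludes the default of [xget]. *)
rewrite /min_nodes; case: xgetP => [n _ [hn nP]|/(_ 22%N)[]//].
by apply/eqP; rewrite eqn_leq nP// min22.
Qed.
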